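(* Let $V$ be a finite set with $n=|V|$, and let $f:2^V\to\mathbb{R}$ be a submodular function with $f(\emptyset)=0$ and $f(V)\le0$, given by an evaluation oracle. The enhanced strongly polynomial algorithm (described in the context) finds an optimal solution to $\min_{S\subseteq V}f(S)$ in time $$O\big(n\cdot\mathrm{AO}^{\downarrow}(f,n^{-O(\log n)})+n^3\cdot\mathrm{EO}+n^4\big).$$ Using the implementation of Approx-SFM by Rescaling-SFM, the running time is $O\big((n^5\cdot\mathrm{EO}+n^6)\log^2 n\big)$.
   Context: A function $f:2^V\to\mathbb{R}$ is submodular if $f(X)+f(Y)\ge f(X\cap Y)+f(X\cup Y)$ for all $X,Y\subseteq V$. $\mathrm{EO}$ is the time of one evaluation of $f$; running time counts arithmetic operations on numbers plus $\mathrm{EO}$ per evaluation. For $z\in\mathbb{R}^V$, $S\subseteq V$: $z(S)=\sum_{v\in S}z(v)$, $z^-(v)=\min\{0,z(v)\}$, $z^-(S)=\sum_{v\in S}z^-(v)$. For $h$ submodular with $h(\emptyset)=0$, $B(h)=\{x: x(S)\le h(S)\ \forall S\subseteq V,\ x(V)=h(V)\}$, $L_h=\max\{\|z\|_1: z\in B(h)\}$. Extreme bases (vertices) of $B(h)$ are the points $x(v_i)=h(\{v_1,\dots,v_i\})-h(\{v_1,\dots,v_{i-1}\})$ for orderings $v_1,v_2,\dots$ of the ground set. Oracle Approx-SFM. Input: a submodular function $h$ and $\delta>0$. Output: a set $W$ and a vector $y\in B(h)$, given as a convex combination of at most $\kappa=O(n)$ extreme bases of $B(h)$, with $h(W)\le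 y^-(V)+\delta L_h$. $\mathrm{AO}(h,\delta)$ denotes its running time, which is taken to depend at least linearly on the size of the ground set. The Rescaling-SFM implementation of this oracle is a geometric rescaling method with running time $O((m^4\cdot\mathrm{EO}+m^5)\log(m\delta^{-1}))$ on a ground set of size $m$, and the same bound applies to the functions $f^{\downarrow}$ below with $\mathrm{EO}$ the evaluation time of $f$. Ring families. The algorithm maintains a digraph $D=(V,F)$ on the current ground set, kept transitive and acyclic between main iterations. Write $u\preceq v$ if there is a directed path (possibly trivial) from $v$ to $u$ in $F$. Let $v^{\downarrow}=\{u:u\preceq v\}$, $v^{\uparrow}=\{u:v\preceq u\}$, $X^{\downarrow}=\bigcup_{v\in X}v^{\downarrow}$, $X^{\uparrow}=\bigcup_{v\in X}v^{\uparrow}$, and $\mathcal{F}=\{X\subseteq V:\text{no arc of }F\text{ leaves }X\}$. Define $\ell(v)=f((V\setminus v^{\uparrow})\cup\{v\})-f(V\setminus v^{\uparrow})$ and $f^{\downarrow}(X)=f(X^{\downarrow})-\ell^-(X^{\downarrow}\setminus X)$ for $X\subseteq V$ (a submodular function on $2^V$). $\mathrm{AO}^{\downarrow}(f,\delta)$ is the maximum of $\mathrm{AO}(f^{\downarrow},\delta)$ over all possible choices of ring families $\mathcal{F}$ (including the contracted functions arising in the algorithm). $\mathrm{Push}(g,h,S)$: for an extreme base $g$ of $B(h)$ given by an ordering, return the extreme base of $B(h)$ of the ordering obtained by moving all elements of $V\setminus S$ before all elements of $S$, keeping the relative orders inside $V\setminus S$ and inside $S$. The enhanced algorithm. Initialize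 $F:=\emptyset$, $T:=\emptyset$. While $\ell^-(V)<0$: (0) Find a nonempty $\bar V\subseteq V$ and a positive integer $b=O(\log n)$ such that $\ell(z)>2\ell^-(V)/(4\kappa n)^{4b}$ for every $z\in V\setminus\bar V$, and at least $|\bar V|/2$ elements $z\in\bar V$ satisfy $\ell(z)\le2\ell^-(V)/(4\kappa n)^{4b-4}$. (Take $\bar V=V^b$ for $V^t=\{z\in V:\ell(z)\le2\ell^-(V)/(4\kappa n)^{4t}\}$ and $b$ the smallest index with $|V^b|\le2|V^{b-1}|$.) Set $\bar\delta:=1/(4\kappa n)^{4b}$ and $\delta:=(2n^2+1)/(4\kappa n)^{4b}$. (1) Let $\bar f$ be the restriction of $f^{\downarrow}$ to subsets of $\bar V$. Call Approx-SFM$(\bar f,\bar\delta)$ to obtain $W\subseteq\bar V$ and $\bar y=\sum_{i=1}^kx_i\bar g_i\in B(\bar f)$, a convex combination of $k\le\kappa$ extreme bases. Fix an ordering $v_1,\dots,v_r$ of $V\setminus\bar V$; set $y(v)=\bar y(v)$, $g_i(v)=\bar g_i(v)$ for $v\in\bar V$, and $y(v_j)=g_i(v_j)=f^{\downarrow}(\bar V\cup\{v_1,\dots,v_j\})-f^{\downarrow}(\bar V\cup\{v_1,\dots,v_{j-1}\})$. Thus $y=\sum_ix_ig_i$. (2) For every $z\in V$ with $f(V\setminus z^{\uparrow})>-2k|V|\cdot y^-(V\setminus z^{\uparrow})$: choose the index $i$ maximizing $x_i\big(f(V\setminus z^{\uparrow})-g_i(V\setminus z^{\uparrow})\big)$,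 say $i=1$; let $g_1':=\mathrm{Push}(g_1,f^{\downarrow},z^{\uparrow})$ and $y':=y+x_1(g_1'-g_1)$; for every $v\in V\setminus z^{\uparrow}$ with $y'(v)>-y'^-(V\setminus z^{\uparrow})$ add the arc $(v,z)$ to $F$. (3) For every $v\in V$ with $y(v)<2\ell^-(V)\delta$: replace $f$ by $S\mapsto f(S\cup v^{\downarrow})-f(v^{\downarrow})$ on the ground set $V:=V\setminus v^{\downarrow}$; then set $f(V):=\min\{0,f(V)\}$ and $T:=T\cup v^{\downarrow}$. (4) Contract every strongly connected component $C$ of $F$ to a single node $v_C$, i.e. replace $V$ by $(V\setminus C)\cup\{v_C\}$ and $f$ by $f'$ with $f'(S)=f(S)$ if $v_C\notin S$, $f'(S)=f((S\setminus\{v_C\})\cup C)$ if $v_C\in S$; replace $F$ by its transitive closure. Return the pre-image of $T$ in the original ground set. Here $n$ in the running time is the size of the original ground set. *)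

(* Defs.v *)
From HB Require Import structures.
From mathcomp Require Import all_boot all_order all_algebra.
From mathcomp Require Import classical_sets reals constructive_ereal ereal exp.
From mathcomp Require Import finset.

Set Implicit Arguments.
Unset Strict Implicit.
Unset Printing Implicit Defensive.
Import Order.TTheory GRing.Theory Num.Theory.
Local Open Scope ring_scope.

(* A set function on the ground set U is a pair (U, h) with h : {set N} -> R,
   of which only the values on subsets of U matter; the restriction of (U, h)
   to U' \subset U is then (U', h).  Likewise a vector of R^U is a function
   N -> R of which only the coordinates in U matter. *)

Section SetFunctions.
Variables (R : realType) (N : finType).
Implicit Types (U S X Y : {set N}) (h : {set N} -> R) (z : N -> R).

Definition submodular_on U h := forall X Y,
  X \subset U -> Y \subset U -> h (X :&: Y) + h (X :|: Y) <= h X + h Y.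

Definition vsum z S : R := \sum_(v in S) z v.
Definition vneg z S : R := \sum_(v in S) Num.min 0 (z v).

Definition in_base U h z :=
  (forall S, S \subset U -> vsum z S <= h S) /\ vsum z U = h U.

Definition base_norm U h : R :=
  sup [set r | exists2 z, in_base U h z & r = \sum_(v in U) `|z v|]%classic.

Definition ordering U (s : seq N) := perm_eq s (enum U).

Definition extreme_base h (s : seq N) (v : N) : R :=
  let p := [set u in take (index v s) s] in h (v |: p) - h p.

Definition push_order S (s : seq N) : seq N :=
  [seq v <- s | v \notin S] ++ [seq v <- s | v \in S].

(* Ring family of a digraph: (v, u) \in F is an arc from v to u. *)
Definition arc (F : {set N * N}) : rel N := [rel v u | (v, u) \in F].
Definition down F v : {set N} := [set u | connect (arc F) v u].
Definition up F v : {set N} := [set u | connect (arc F) u v].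
Definition down_set F X : {set N} := \bigcup_(v in X) down F v.

Definition transitive_acyclic U (F : {set N * N}) :=
  [/\ F \subset setX U U, irreflexive (arc F) & transitive (arc F)].

Definition ell U h F (v : N) : R :=
  h (v |: (U :\: up F v)) - h (U :\: up F v).

Definition fdown U h F X : R :=
  h (down_set F X) - vneg (ell U h F) (down_set F X :\: X).

Record wterm := WTerm {
  coef : R; order_of : seq N; base_of : N -> R }.

Record sfm_output := SfmOutput {
  out_set : {set N}; out_vec : N -> R; out_terms : seq wterm }.

Record sfm_oracle := SfmOracle {
  orc_out : {set N} -> ({set N} -> R) -> R -> sfm_output;
  orc_time : {set N} -> ({set N} -> R) -> R -> R }.

Definition approx_sfm_output (kappa : nat) U h (delta : R) (o : sfm_output) :=
  [/\ out_set o \subset U,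
      [/\ (size (out_terms o) <= kappa)%N,
          \sum_(t <- out_terms o) coef t = 1,
          forall i, (i < size (out_terms o))%N ->
            let t := nth (WTerm 0 [::] (fun=> 0)) (out_terms o) i in
            [/\ 0 <= coef t, ordering U (order_of t) &
                {in U, base_of t =1 extreme_base h (order_of t)}] &
          {in U, forall v,
             out_vec o v = \sum_(t <- out_terms o) coef t * base_of t v}],
      in_base U h (out_vec o) &
      h (out_set o) <= vneg (out_vec o) U + delta * base_norm U h].

(* The bound kappa on the number of terms is for ground sets of size <= n. *)
Definition approx_sfm (n kappa : nat) (O : sfm_oracle) :=
  forall U h (delta : R),
    U != set0 -> (#|U| <= n)%N ->
    submodular_on U h -> h set0 = 0 -> 0 < delta ->
    approx_sfm_output kappa U h delta (orc_out O U h delta).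

(* AO(h, delta) / |U| does not increase under restriction of the ground set. *)
Definition at_least_linear (O : sfm_oracle) :=
  forall U' U h (delta : R),
    U' != set0 -> U' \subset U ->
    submodular_on U h -> h set0 = 0 -> 0 < delta ->
    #|U|%:R * orc_time O U' h delta <= #|U'|%:R * orc_time O U h delta.

End SetFunctions.

(* Cost-annotated computations.  Every arithmetic operation or comparison on
   numbers costs 1 (the primitives addM .. ltM below), and cost is otherwise
   incurred only through evaluators and oracle calls; manipulating nodes, sets,
   orderings and digraphs is not an operation on numbers. *)
Definition costed (R : realType) (A : Type) : Type := (A * R)%type.

Section Cost.
Variable R : realType.

Definition ret A (a : A) : costed R A := (a, 0).
Definition bind A B (m : costed R A) (k : A -> costed R B) : costed R B :=
  ((k m.1).1, m.2 + (k m.1).2).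
Definition charge A (c : R) (a : A) : costed R A := (a, c).

Definition addM (x y : R) := charge 1 (x + y).
Definition subM (x y : R) := charge 1 (x - y).
Definition mulM (x y : R) := charge 1 (x * y).
Definition divM (x y : R) := charge 1 (x / y).
Definition minM (x y : R) := charge 1 (Num.min x y).
Definition leM (x y : R) := charge 1 (x <= y).
Definition ltM (x y : R) := charge 1 (x < y).

Fixpoint foldM A B (k : B -> A -> costed R B) (b : B) (s : seq A) : costed R B :=
  if s is a :: s' then bind (k b a) (fun b' => foldM k b' s') else ret b.

End Cost.

Notation "'let*' x ':=' m 'in' k" := (bind m (fun x => k))
  (at level 200, x name, m at level 100, k at level 200).

Section Subroutines.
Variables (R : realType) (N : finType).
Variable enumS : {set N} -> seq N.

Definition evaluator := {set N} -> costed R R.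

Definition upd (z : N -> R) (v : N) (x : R) : N -> R :=
  fun u => if u == v then x else z u.

Definition tabulateM (e : N -> costed R R) (s : seq N) : costed R (N -> R) :=
  foldM (fun z v => let* x := e v in ret R (upd z v x))
    (fun=> 0) s.

Definition vsumM (z : N -> R) (S : {set N}) : costed R R :=
  foldM (fun a v => addM a (z v)) 0 (enumS S).

Definition vnegM (z : N -> R) (S : {set N}) : costed R R :=
  foldM (fun a v => let* x := minM 0 (z v) in addM a x) 0 (enumS S).

Definition filterM (p : N -> costed R bool) (S : {set N}) : costed R {set N} :=
  foldM (fun A v => let* c := p v in ret R (if c then v |: A else A))
    set0 (enumS S).

Definition ellM (V : {set N}) (ev : evaluator) (F : {set N * N}) :
    costed R (N -> R) :=
  tabulateM (fun v =>
    let* a := ev (v |: (V :\: up F v)) in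
    let* b := ev (V :\: up F v) in
    subM a b) (enumS V).

Definition fdownM (ev : evaluator) (F : {set N * N}) (l : N -> R) : evaluator :=
  fun X =>
    let* a := ev (down_set F X) in
    let* b := vnegM l (down_set F X :\: X) in
    subM a b.

(* Marginals of h when the elements of s are added to A one after the other. *)
Definition greedyM (h : evaluator) (A : {set N}) (s : seq N) :
    costed R (N -> R) :=
  let* a0 := h A in
  let* r := foldM (fun (st : {set N} * R * (N -> R)) v =>
      let: (A', a, g) := st in
      let* b := h (v |: A') in
      let* x := subM b a in
      ret R (v |: A', b, upd g v x))
    (A, a0, fun=> 0) s in
  ret R r.2.

(* Starting from Vprev = V^{t-1} and q = (4 kappa n)^{4(t-1)}, where
   Q = (4 kappa n)^4 and l2 = 2 ell^-(V), returns V^b and (4 kappa n)^{4b} for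
   the first b >= t with |V^b| <= 2 |V^{b-1}|.  The fuel only makes the
   search structurally recursive. *)
Fixpoint levelM (V : {set N}) (l : N -> R) (l2 Q : R) (fuel : nat)
    (Vprev : {set N}) (q : R) : costed R ({set N} * R) :=
  let* q' := mulM q Q in
  let* thr := divM l2 q' in
  let* Vt := filterM (fun v => leM (l v) thr) V in
  let* d := mulM 2 #|Vprev|%:R in
  let* c := leM #|Vt|%:R d in
  if c then ret R (Vt, q') else
  if fuel is fuel'.+1 then levelM V l l2 Q fuel' Vt q' else ret R (Vt, q').

(* A term maximising coef t * (a - g(S)), g being the base of t. *)
Definition best_termM (a : R) (S : {set N}) (ts : seq (wterm R N)) :
    costed R (option (wterm R N)) :=
  let* r := foldM (fun (best : option (R * wterm R N)) t =>
      let* gS := vsumM (base_of t) S in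
      let* d := subM a gS in
      let* p := mulM (coef t) d in
      if best is Some (q, _) then
        let* c := ltM q p in
        ret R (if c then Some (p, t) else best)
      else ret R (Some (p, t)))
    None ts in
  ret R (omap snd r).

End Subroutines.

Section EnhancedAlgorithm.
Variables (R : realType) (V0 : finType).

(* A node of the current ground set is the set of the original elements that
   have been contracted to it. *)
Local Notation N := {set V0}.

Variables (f0 : {set V0} -> R) (EO : R) (kappa : nat) (O : sfm_oracle R N).

(* enumS fixes the order in which the elements of a set are scanned, and the
   ordering of the nodes outside Vbar. *)
Variable enumS : {set N} -> seq N.

Let n : nat := #|V0|.

Record state := State {
  nodes : {set N}; evalf : evaluator R N; arcs : {set N * N};
  taken : {set N} }.

Definition fval (s : state) (X : {set N}) : R := (evalf s X).1.

Definition init : state :=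
  State [set [set v] | v : V0] (fun X => charge EO (f0 (cover X))) set0 set0.

(* The closures, ell (through l) and f^down are those of the digraph
   F at the start of the iteration; the new arcs are collected in the
   accumulator. *)
Definition add_arcsM (V : {set N}) (ev : evaluator R N) (F : {set N * N})
    (l : N -> R) (y : N -> R) (ts : seq (wterm R N)) : costed R {set N * N} :=
  foldM (fun F' z =>
    let S := V :\: up F z in
    let* fS := ev S in
    let* yS := vnegM enumS y S in
    let* k2 := mulM (- 2) (size ts)%:R in
    let* k2V := mulM k2 #|V|%:R in
    let* thr := mulM k2V yS in
    let* test := ltM thr fS in
    if ~~ test then ret R F' else
    let* best := best_termM enumS fS S ts in
    if best is Some t then
      let* g' := greedyM (fdownM enumS ev F l) set0
                   (push_order (up F z) (order_of t)) in
      let* y' := tabulateM (fun v =>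
          let* d := subM (g' v) (base_of t v) in
          let* xd := mulM (coef t) d in
          addM (y v) xd) (enumS V) in
      let* y'S := vnegM enumS y' S in
      let* m := subM 0 y'S in
      let* A := filterM enumS (fun v => ltM m (y' v)) S in
      ret R (F' :|: [set (v, z) | v in A])
    else ret R F') F (enumS V).

(* f(S) := f(S u A) - f(A) on V := V \ A, followed by f(V) := min(0, f(V)). *)
Definition contract_downM (s : state) (v : N) : costed R state :=
  let A := down (arcs s) v in
  let V' := nodes s :\: A in
  let* fA := evalf s A in
  let ev1 : evaluator R N :=
    fun S => let* a := evalf s (S :|: A) in subM a fA in
  let* top := ev1 V' in
  let* cap := minM 0 top in
  let ev2 : evaluator R N := fun S => if S == V' then ret R cap else ev1 S in
  ret R (State V' ev2 (arcs s :&: setX V' V') (taken s :|: A)).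

Definition contract_forcedM (s : state) (y : N -> R) (thr : R) : costed R state :=
  foldM (fun s' v =>
    if v \notin nodes s' then ret R s' else
    let* c := ltM (y v) thr in
    if c then contract_downM s' v else ret R s') s (enumS (nodes s)).

Definition scc_node (F : {set N * N}) (u : N) : N :=
  cover [set w | connect (arc F) u w && connect (arc F) w u].

Definition quotient_arcs (F : {set N * N}) : {set N * N} :=
  [set (scc_node F a.1, scc_node F a.2) |
     a in F & scc_node F a.1 != scc_node F a.2].

Definition transitive_closure (F : {set N * N}) : {set N * N} :=
  [set a | (a.1 != a.2) && connect (arc F) a.1 a.2].

(* A set S of new nodes is evaluated at its preimage. *)
Definition contract_scc (s : state) : state :=
  let F := arcs s in
  State [set scc_node F u | u in nodes s]
        (fun S => evalf s [set u in nodes s | scc_node F u \in S])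
        (transitive_closure (quotient_arcs F))
        (taken s).

(* Test of the while loop, followed by a main iteration; None when the test
   fails. *)
Definition iterationM (s : state) : costed R (option state) :=
  let V := nodes s in
  let ev := evalf s in
  let F := arcs s in
  let* l := ellM enumS V ev F in
  let* lV := vnegM enumS l V in
  let* go := ltM lV 0 in
  if ~~ go then ret R None else
  let* l2 := mulM 2 lV in
  let* M1 := mulM 4 kappa%:R in
  let* M := mulM M1 n%:R in
  let* M2 := mulM M M in
  let* Q := mulM M2 M2 in
  let* Vlev0 := filterM enumS (fun v => leM (l v) l2) V in
  let* lev := levelM enumS V l l2 Q #|V| Vlev0 1 in
  let Vbar := lev.1 in
  let* deltabar := divM 1 lev.2 in
  let* n2 := mulM n%:R n%:R in
  let* n3 := mulM 2 n2 in
  let* n4 := addM n3 1 in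
  let* delta := mulM n4 deltabar in
  let h := fdown V (fval s) F in
  let* o := charge (orc_time O Vbar h deltabar) (orc_out O Vbar h deltabar) in
  let vs := enumS (V :\: Vbar) in
  let* e := greedyM (fdownM enumS ev F l) Vbar vs in
  let extend (z : N -> R) := fun v => if v \in Vbar then z v else e v in
  let y := extend (out_vec o) in
  let ts := [seq WTerm (coef t) (order_of t ++ vs) (extend (base_of t))
               | t <- out_terms o] in
  let* F' := add_arcsM V ev F l y ts in
  let* thr := mulM l2 delta in
  let* s' := contract_forcedM (State V ev F' (taken s)) y thr in
  ret R (Some (contract_scc s')).

(* runs_from s S c: started in s, the loop terminates after total cost c, and
   S is the preimage of the final T. *)
Inductive runs_from (s : state) : {set V0} -> R -> Prop :=
| runs_stop c : iterationM s = (None, c) -> runs_from s (cover (taken s)) c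
| runs_next s' c S c' : iterationM s = (Some s', c) ->
    runs_from s' S c' -> runs_from s S (c + c').

Definition enhanced_sfm := runs_from init.

Inductive reached : state -> Prop :=
| reached_init : reached init
| reached_next s s' : reached s -> (iterationM s).1 = Some s' -> reached s'.

(* AO^down(f, delta): the contracted functions arising in the algorithm are the
   functions of the reached states, the first of which is f itself. *)
Definition AO_down (delta : R) : \bar R :=
  ereal_sup [set a | exists s, exists2 F,
    reached s /\ transitive_acyclic (nodes s) F &
    a = (orc_time O (nodes s) (fdown (nodes s) (fval s) F) delta)%:E]%classic.

(* The Rescaling-SFM bound on the time for the functions f^down and their
   restrictions; delta is kept away from 1 because ln (m / delta) vanishes
   at m = delta = 1. *)
Definition rescaling_time (C0 : R) :=
  forall (s : state) (F : {set N * N}) (U : {set N}) (delta : R),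
    reached s -> transitive_acyclic (nodes s) F ->
    U != set0 -> U \subset nodes s -> 0 < delta <= 2^-1 ->
    let m : R := #|U|%:R in
    orc_time O U (fdown (nodes s) (fval s) F) delta
      <= C0 * (m ^+ 4 * EO + m ^+ 5) * ln (m / delta).

End EnhancedAlgorithm.

(* Main.v *)
Require Import Defs.
From HB Require Import structures.
From mathcomp Require Import all_boot all_order all_algebra.
From mathcomp Require Import classical_sets reals constructive_ereal ereal exp.
From mathcomp Require Import fintype finset.
From mathcomp Require Import lra ring zify.

Set Implicit Arguments.
Unset Strict Implicit.
Unset Printing Implicit Defensive.
Import Order.TTheory GRing.Theory Num.Theory.
Local Open Scope ring_scope.

Import Defs.

(** The function [f] is kept together with a digraph such that every minimizer
    of [f] is closed: no arc leaves it.  The numbers [ell v] bound from below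
    what [v] adds to a closed set, so once they are all nonnegative the empty
    set is a minimizer (ell_nonneg_min0), and the elements taken so far form a
    minimizer of the original function.

    An iteration calls the oracle for [f^down] on a level set of [ell], and
    prolongs its answer to a point [y] of the base polytope of [f^down] on the
    whole ground set.  Since [y >= ell^-] there, little is lost outside the
    level set (extended_certificate), and every [v] whose coordinate is very
    negative lies in all minimizers (very_negative_forced).  For an element [z]
    with [f (V \ z^up)] large, one push of the best term of [y] creates a
    coordinate [v] that dominates all negative ones in [V \ z^up]; a minimizer
    containing [v] then contains [z] (exists_large_coordinate,
    large_coordinate_arc).  If [f (V \ z^up)] is not large although [ell z] is
    very negative, some coordinate of [y] must be very negative
    (ell_ge_of_failed_test).  So in each iteration either a node disappears, or
    at least half of the level set receives a new arc.

    For the running time, let [m] be the number of nodes and [q] the number of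
    ordered pairs of nodes that are not arcs; [m] and [q] never increase.  The
    potential [q + n m] is at most [2 n ^ 2] and decreases in each iteration
    by at least half of 1 plus the number of pushes; this pays for everything
    outside the oracle, since a push costs [O(n EO + n ^ 2)].  An oracle call on
    a level set [U] costs at most [#|U| / m] times a call on all nodes, and
    [4 sqrt q + m <= 5 n] decreases by at least [#|U| / m] in each iteration
    (level_potential_drop), so all oracle calls together cost as much as [5 n]
    calls on the whole ground set.  The level sets more than double during
    the search for the level, so its index, and with it the logarithm of the
    accuracy divided by [ln n], is [O(log n)]. *)

(** * Sums over sets and submodular marginals *)

Section SetSums.
Variables (R : realType) (N : finType).
Implicit Types (X Y Z S U : {set N}) (z g : N -> R) (h : {set N} -> R).

Lemma vsum0 z : vsum z set0 = 0.
Proof. by rewrite /vsum big_set0. Qed.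

Lemma vsum1 z v : vsum z [set v] = z v.
Proof. by rewrite /vsum big_set1. Qed.

Lemma vsumD z X Y : X \subset Y -> vsum z Y = vsum z X + vsum z (Y :\: X).
Proof. by move=> sXY; rewrite /vsum (big_setID X) /= (setIidPr sXY). Qed.

Lemma vsumU1 z X v : v \notin X -> vsum z (v |: X) = z v + vsum z X.
Proof. by move=> vX; rewrite /vsum big_setU1. Qed.

Lemma vsum_modular z X Y :
  vsum z (X :&: Y) + vsum z (X :|: Y) = vsum z X + vsum z Y.
Proof.
rewrite (vsumD z (subsetUl X Y)) (vsumD z (subsetIr X Y)).
have -> : (X :|: Y) :\: X = Y :\: (X :&: Y).
  by apply/setP => v; rewrite !inE; case: (v \in X); case: (v \in Y).
ring.
Qed.

Lemma eq_vsum z g X : {in X, z =1 g} -> vsum z X = vsum g X.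
Proof. by move=> eqz; apply: eq_bigr. Qed.

Lemma eq_vneg z g X : {in X, z =1 g} -> vneg z X = vneg g X.
Proof. by move=> eqz; apply: eq_bigr => v /eqz ->. Qed.

Lemma ler_vneg z g X : {in X, forall v, z v <= g v} -> vneg z X <= vneg g X.
Proof.
move=> lez; apply: ler_sum => v /lez zg.
by rewrite le_min ge_min lexx /= ge_min zg orbT.
Qed.

Lemma vneg_le0 z X : vneg z X <= 0.
Proof. by apply: sumr_le0 => v _; rewrite ge_min lexx. Qed.

Lemma vneg_le_vsum z X : vneg z X <= vsum z X.
Proof. by apply: ler_sum => v _; rewrite ge_min lexx orbT. Qed.

Lemma vnegD z X Y : X \subset Y -> vneg z Y = vneg z X + vneg z (Y :\: X).
Proof. exact: (vsumD (fun v => Num.min 0 (z v))). Qed.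

Lemma vneg_modular z X Y :
  vneg z (X :&: Y) + vneg z (X :|: Y) = vneg z X + vneg z Y.
Proof. exact: (vsum_modular (fun v => Num.min 0 (z v))). Qed.

Lemma vneg_sub z X Y : X \subset Y -> vneg z Y <= vneg z X.
Proof. by move=> /(vnegD z) ->; rewrite gerDl vneg_le0. Qed.

Lemma vneg_ge_card z X a : 0 <= a -> {in X, forall v, - a <= z v} ->
  - (#|X|%:R * a) <= vneg z X.
Proof.
move=> a0 za; rewrite -mulrN mulr_natl -sumr_const; apply: ler_sum => v /za.
by rewrite le_min oppr_le0 a0.
Qed.

Lemma vsum_le_card z X a : {in X, forall v, z v <= a} ->
  vsum z X <= #|X|%:R * a.
Proof.
by move=> za; rewrite mulr_natl -sumr_const; apply: ler_sum => v /za.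
Qed.

Lemma normE (x : R) : `|x| = x - 2 * Num.min 0 x.
Proof.
have [x0|/ltW x0] := leP 0 x; first by rewrite ger0_norm // mulr0 subr0.
by rewrite ler0_norm //; ring.
Qed.

(** Diminishing returns, for the marginal of a single element. *)
Lemma submodular_marginal U h X Y v : submodular_on U h ->
  X \subset Y -> v |: Y \subset U -> v \notin Y ->
  h (v |: Y) - h Y <= h (v |: X) - h X.
Proof.
move=> subh sXY; rewrite subUset => /andP[vU YU] vY.
have /subh/(_ YU) : v |: X \subset U by rewrite subUset vU (subset_trans sXY).
have -> : (v |: X) :&: Y = X.
  apply/setP => u; rewrite !inE; case: eqP => [->|_] /=.
    by rewrite (negPf vY); apply/esym/(contraNF _ vY)/(subsetP sXY).
  by case uX: (u \in X) => //=; apply: (subsetP sXY).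
have -> : (v |: X) :|: Y = v |: Y by rewrite -setUA (setUidPr sXY).
lra.
Qed.

End SetSums.

(** * Extreme bases *)

Section ExtremeBases.
Variables (R : realType) (N : finType).
Implicit Types (X Y S U : {set N}) (h : {set N} -> R) (s p q : seq N).

Lemma ordering_uniq U s : ordering U s -> uniq s.
Proof. by move=> /perm_uniq ->; apply: enum_uniq. Qed.

Lemma ordering_mem U s : ordering U s -> s =i U.
Proof. by move=> /perm_mem eqs v; rewrite eqs mem_enum. Qed.

Lemma ordering_set U s : ordering U s -> [set v in s] = U.
Proof. by move=> /ordering_mem eqs; apply/setP => v; rewrite inE eqs. Qed.

Lemma ordering_size U s : ordering U s -> size s = #|U|.
Proof. by move=> /perm_size ->; rewrite -cardE. Qed.

Lemma orderingP U s : uniq s -> s =i U -> ordering U s.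
Proof.
move=> us eqs; apply: uniq_perm => //; first exact: enum_uniq.
by move=> v; rewrite mem_enum eqs.
Qed.

Lemma extreme_base_split h p v q : v \notin p ->
  extreme_base h (p ++ v :: q) v = h (v |: [set u in p]) - h [set u in p].
Proof.
move=> vp; rewrite /extreme_base index_cat (negPf vp) /= eqxx addn0.
by rewrite take_size_cat.
Qed.

Lemma extreme_base_cat h p q v : v \in p ->
  extreme_base h (p ++ q) v = extreme_base h p v.
Proof.
by move=> vp; rewrite /extreme_base index_cat vp take_cat index_mem vp.
Qed.

Lemma set_rcons p v : [set u in rcons p v] = v |: [set u in p].
Proof. by apply/setP => u; rewrite !inE mem_rcons inE. Qed.

Lemma extreme_base_prefix h p q : uniq p -> h set0 = 0 ->
  vsum (extreme_base h (p ++ q)) [set u in p] = h [set u in p].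
Proof.
move=> + h0; elim/last_ind: p q => [|p v IH] q.
  by move=> _; rewrite (_ : [set u in [::]] = set0) ?vsum0 ?h0.
rewrite rcons_uniq => /andP[vp up].
rewrite set_rcons vsumU1 ?inE // cat_rcons IH // extreme_base_split //.
lra.
Qed.

(** Induction along the ordering: adding its last element to a subset of the
    ground set yields at least the marginal that defines the coordinate. *)
Lemma extreme_base_le U h s S : submodular_on U h -> h set0 = 0 ->
  uniq s -> [set u in s] \subset U -> S \subset [set u in s] ->
  vsum (extreme_base h s) S <= h S.
Proof.
move=> subh h0; elim/last_ind: s S => [|p v IH] S.
  move=> _ _; rewrite (_ : [set u in [::]] = set0) // subset0 => /eqP ->.
  by rewrite vsum0 h0.
rewrite rcons_uniq set_rcons => /andP[vp up] sU sS.
have pU : [set u in p] \subset U by apply: subset_trans sU; apply: subsetUr.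
have sumE X : X \subset [set u in p] ->
    vsum (extreme_base h (rcons p v)) X = vsum (extreme_base h p) X.
  move=> Xp; apply: eq_vsum => u /(subsetP Xp); rewrite inE => ?.
  by rewrite -cats1 extreme_base_cat.
have [vS|vS] := boolP (v \in S); last first.
  have Sp : S \subset [set u in p].
    apply/subsetP => u uS; have := subsetP sS u uS; rewrite !inE.
    by case: eqP uS vS => // -> ->.
  by rewrite sumE // IH.
have Sp : S :\ v \subset [set u in p] by rewrite subDset.
have vSv : v \notin S :\ v by rewrite !inE eqxx.
rewrite -(setD1K vS) vsumU1 // sumE //.
have := IH _ up pU Sp.
rewrite -cats1 extreme_base_split //.
have := submodular_marginal subh Sp sU; rewrite inE => /(_ vp).
lra.
Qed.

Lemma extreme_base_in_base U h s : submodular_on U h -> h set0 = 0 ->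
  ordering U s -> in_base U h (extreme_base h s).
Proof.
move=> subh h0 os; have us := ordering_uniq os; have sU := ordering_set os.
split=> [S SU|]; first by apply: (extreme_base_le subh); rewrite ?sU.
by have := extreme_base_prefix [::] us h0; rewrite cats0 sU.
Qed.

Lemma push_ordering U S s : ordering U s -> ordering U (push_order S s).
Proof.
move=> os; apply: perm_trans os.
by rewrite /push_order perm_catC; apply/permPl/perm_filterC.
Qed.

Lemma push_tight U S h s : ordering U s -> h set0 = 0 ->
  vsum (extreme_base h (push_order S s)) (U :\: S) = h (U :\: S).
Proof.
move=> os h0.
have <- : [set u in [seq v <- s | v \notin S]] = U :\: S.
  by apply/setP => u; rewrite !inE mem_filter (ordering_mem os).
by rewrite extreme_base_prefix ?filter_uniq ?(ordering_uniq os).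
Qed.

(** Outside [S], pushing only shrinks the set of predecessors of an element,
    so diminishing returns raise its coordinate. *)
Lemma push_ge U S h s v : submodular_on U h -> ordering U s ->
  v \in U :\: S -> extreme_base h s v <= extreme_base h (push_order S s) v.
Proof.
move=> subh os; rewrite inE => /andP[vS vU].
have us := ordering_uniq os; have ms := ordering_mem os.
have vs : v \in s by rewrite ms.
case/splitPr: vs us ms => p q us ms.
have vp : v \notin p by move: us; rewrite cat_uniq /= => /and3P[_ /norP[]].
rewrite /push_order filter_cat /= vS -catA cat_cons.
rewrite !extreme_base_split ?mem_filter ?(negPf vp) ?andbF //.
apply: (submodular_marginal subh); last by rewrite inE.
  by apply/subsetP => u; rewrite !inE mem_filter => /andP[].
apply/subsetP => u; rewrite -ms !inE mem_cat inE.
by case/predU1P => [->|->]; rewrite ?eqxx ?orbT.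
Qed.

End ExtremeBases.

(** * Down-closed sets of a digraph *)

Section Digraphs.
Variable N : finType.
Implicit Types (U X Y : {set N}) (F : {set N * N}) (u v w : N).

Definition down_closed F X :=
  forall u v, (u, v) \in F -> u \in X -> v \in X.

Lemma down_closed_connect F X u v :
  down_closed F X -> connect (arc F) u v -> u \in X -> v \in X.
Proof.
move=> clX /connectP[p + ->]; elim: p u => //= w p IH u /andP[uw pw] uX.
exact/(IH _ pw)/(clX u).
Qed.

Lemma down_set_closed F X : down_closed F (down_set F X).
Proof.
move=> u v uv /bigcupP[x xX]; rewrite inE => xu.
apply/bigcupP; exists x => //; rewrite inE.
by apply: connect_trans xu _; apply: connect1.
Qed.

Lemma sub_down_set F X : X \subset down_set F X.
Proof.
by apply/subsetP => v vX; apply/bigcupP; exists v; rewrite ?inE ?connect0.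
Qed.

Lemma down_set_min F X Y : down_closed F Y -> X \subset Y ->
  down_set F X \subset Y.
Proof.
move=> clY sXY; apply/bigcupsP => v vX; apply/subsetP => u; rewrite inE => vu.
exact: (down_closed_connect clY vu (subsetP sXY v vX)).
Qed.

Lemma down_setS F X Y : X \subset Y -> down_set F X \subset down_set F Y.
Proof.
move=> sXY; apply: down_set_min; first exact: down_set_closed.
exact: subset_trans (sub_down_set F Y).
Qed.

Lemma down_set_id F X : down_closed F X -> down_set F X = X.
Proof.
by move=> clX; apply/eqP; rewrite eqEsubset sub_down_set down_set_min.
Qed.

Lemma down_setU F X Y : down_set F (X :|: Y) = down_set F X :|: down_set F Y.
Proof. exact: bigcup_setU. Qed.

Lemma down_setI F X Y :
  down_set F (X :&: Y) \subset down_set F X :&: down_set F Y.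
Proof. by rewrite subsetI !down_setS ?subsetIl ?subsetIr. Qed.

Lemma down_closedI F X Y :
  down_closed F X -> down_closed F Y -> down_closed F (X :&: Y).
Proof.
by move=> cX cY u v uv; rewrite !inE => /andP[/(cX _ _ uv)-> /(cY _ _ uv)->].
Qed.

Lemma ground_closed U F : F \subset setX U U -> down_closed F U.
Proof. by move=> /subsetP sF u v /sF; rewrite inE => /andP[]. Qed.

Lemma down_set_sub U F X : F \subset setX U U -> X \subset U ->
  down_set F X \subset U.
Proof. by move=> /ground_closed clU; apply: down_set_min. Qed.

Lemma diff_up_closed U F v : F \subset setX U U ->
  down_closed F (U :\: up F v).
Proof.
move=> sF u w uw; rewrite !inE => /andP[uv uU].
rewrite (ground_closed sF uw uU) andbT; apply: contra uv.
by apply: connect_trans; apply: connect1.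
Qed.

Lemma closed_sub_diff_up U F X v : X \subset U -> down_closed F X ->
  v \notin X -> X \subset U :\: up F v.
Proof.
move=> sXU clX vX; apply/subsetP => u uX; rewrite !inE (subsetP sXU) // andbT.
by apply: contra vX => /(down_closed_connect clX); apply.
Qed.

Lemma connect_transitive F u v : transitive (arc F) ->
  connect (arc F) u v = (u == v) || ((u, v) \in F).
Proof.
move=> trF; apply/idP/idP; last first.
  by case/predU1P => [->|uv]; [apply: connect0 | apply: connect1].
case/connectP => p + ->; elim: p u => [|w p IH] u /=; first by rewrite eqxx.
case/andP => uw /IH/predU1P[<-|wl]; first by rewrite [_ \in F]uw orbT.
by rewrite [_ \in F](trF w) ?orbT.
Qed.

Lemma connect_antisym U F u v : transitive_acyclic U F ->
  connect (arc F) u v -> connect (arc F) v u -> u = v.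
Proof.
case=> _ irF trF; rewrite !connect_transitive //.
case/predU1P => // uv /predU1P[//|vu].
by have := irF u; rewrite (trF v).
Qed.

Lemma add_min_closed U F v : transitive_acyclic U F -> v \in U ->
  down_closed F (v |: (U :\: up F v)).
Proof.
move=> taF vU u w uw; have [sF _ _] := taF.
rewrite !in_setU1 => /predU1P[uv|uX]; last first.
  by rewrite (diff_up_closed sF uw uX) orbT.
case: eqVneq => //= wv; rewrite uv in uw.
rewrite !inE (ground_closed sF uw vU) andbT; apply: contra wv => cwv.
by rewrite (connect_antisym taF cwv) // connect1.
Qed.

End Digraphs.

(** * The extension of a function from a ring family *)

Section RingFamily.
Variables (R : realType) (N : finType).
Variables (V : {set N}) (f : {set N} -> R) (F : {set N * N}).
Hypothesis taF : transitive_acyclic V F.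
Hypothesis subf : submodular_on V f.
Implicit Types (X Y S U W : {set N}) (y z g : N -> R).

Local Notation l := (ell V f F).
Local Notation h := (fdown V f F).

Let sF : F \subset setX V V. Proof. by case: taF. Qed.

Lemma ell_le_marginal X v : X \subset V -> down_closed F X ->
  v \in V -> v \notin X -> l v <= f (v |: X) - f X.
Proof.
move=> XV clX vV vX; apply: (submodular_marginal subf).
- exact: closed_sub_diff_up.
- by rewrite subUset sub1set vV subsetDl.
- by rewrite !inE connect0.
Qed.

(** Between two closed sets one can climb through closed sets by adding one
    element at a time, and each step gains at least [l v], hence at least
    [min 0 (l v)]; subtracting these lower bounds leaves a monotone function. *)
Lemma potential_mono X Y : X \subset Y -> Y \subset V ->
  down_closed F X -> down_closed F Y ->
  f X - vneg l X <= f Y - vneg l Y.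
Proof.
move=> + + clX; move eqm: #|Y :\: X| => m.
elim: m Y eqm => [|m IH] Y eqm sXY YV clY.
  suff -> : Y = X by [].
  by apply/eqP; rewrite eqEsubset sXY -setD_eq0 -cards_eq0 eqm andbT.
have [v0 v0D] : exists v, v \in Y :\: X by apply/set0Pn; rewrite -card_gt0 eqm.
pose v := [arg max_(v > v0 in Y :\: X) #|down F v|].
have [vD maxv] : v \in Y :\: X /\
    forall u, u \in Y :\: X -> (#|down F u| <= #|down F v|)%N.
  by rewrite /v; case: arg_maxnP.
have /andP[vX vY] : (v \notin X) && (v \in Y) by rewrite -in_setD.
have sXYv : X \subset Y :\ v by rewrite subsetD1 sXY.
have YvV : Y :\ v \subset V by apply: subset_trans YV; apply: subD1set.
(* An element of Y outside X with an arc to v would have a larger down-set. *)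
have clYv : down_closed F (Y :\ v).
  move=> u w uw; rewrite !inE => /andP[uv uY]; rewrite (clY _ _ uw uY) andbT.
  apply/eqP => wv; rewrite wv in uw.
  have uX : u \notin X by apply: contra vX; apply: clX.
  have /maxv : u \in Y :\: X by rewrite inE uX.
  rewrite leqNgt => /negP; apply; apply: proper_card; apply/properP; split.
    apply/subsetP => w'; rewrite !inE; apply: connect_trans.
    exact: connect1.
  exists u; rewrite inE ?connect0 //; apply: contra uv => vu.
  by apply/eqP/(connect_antisym taF) => //; apply: connect1.
have := ell_le_marginal YvV clYv (subsetP YV v vY).
rewrite !inE eqxx setD1K // => /(_ isT) lv.
have {}IH : f X - vneg l X <= f (Y :\ v) - vneg l (Y :\ v).
  apply: IH => //; move: eqm.
  rewrite (cardsD1 v (Y :\: X)) vD add1n => -[<-].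
  by congr #|pred_of_set _|; apply/setP => u; rewrite !inE andbCA.
have : vneg l Y = Num.min 0 (l v) + vneg l (Y :\ v).
  by rewrite -{1}(setD1K vY) [LHS]vsumU1 ?inE ?eqxx.
have : Num.min 0 (l v) <= l v by rewrite ge_min lexx orbT.
lra.
Qed.

Lemma fdownE X : h X = f (down_set F X) - vneg l (down_set F X) + vneg l X.
Proof. by rewrite /fdown (vnegD l (sub_down_set F X)); ring. Qed.

Lemma fdown_closed X : down_closed F X -> h X = f X.
Proof. by move=> clX; rewrite fdownE down_set_id //; ring. Qed.

Lemma fdown_ge X : f (down_set F X) <= h X.
Proof. by rewrite /fdown lerDl oppr_ge0 vneg_le0. Qed.

Lemma fdown0 : h set0 = f set0.
Proof. by apply: fdown_closed => u v _; rewrite inE. Qed.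

Lemma fdownV : h V = f V.
Proof. exact/fdown_closed/ground_closed. Qed.

(** With [phi X = f X - l^-(X)] one has [h X = phi (down_set X) + l^-(X)],
    where the last summand is modular and [phi] is monotone on closed sets; the
    loss from [down_set (X :&: Y)] being smaller than the intersection of the
    down-sets thus has the right sign. *)
Lemma fdown_submodular : submodular_on V h.
Proof.
move=> X Y XV YV; rewrite !fdownE down_setU.
have DX := down_set_sub sF XV; have DY := down_set_sub sF YV.
have cX := @down_set_closed _ F X; have cY := @down_set_closed _ F Y.
have DI : down_set F X :&: down_set F Y \subset V.
  by apply: subset_trans DX; apply: subsetIl.
have := potential_mono (down_setI F X Y) DI (@down_set_closed _ F _)
  (down_closedI cX cY).
have := subf DX DY.
have := vneg_modular l (down_set F X) (down_set F Y).
have := vneg_modular l X Y.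
lra.
Qed.

(** Only the monotonicity of [phi] is involved: the marginals of [h] on the
    whole of [2 ^ V] inherit the lower bounds that [l] gives on closed sets. *)
Lemma fdown_gain X Y : X \subset Y -> Y \subset V ->
  vneg l (Y :\: X) <= h Y - h X.
Proof.
move=> sXY YV; rewrite !fdownE (vnegD l sXY).
have := potential_mono (down_setS F sXY) (down_set_sub sF YV)
  (@down_set_closed _ F X) (@down_set_closed _ F Y).
lra.
Qed.

Lemma base_ge_ell U z v : U \subset V -> in_base U h z -> v \in U ->
  Num.min 0 (l v) <= z v.
Proof.
move=> UV [leh zU] vU.
have := leh (U :\ v) (subD1set _ _); have := fdown_gain (subD1set U v) UV.
have -> : U :\: (U :\ v) = [set v].
  by apply/setP => u; rewrite !inE; case: eqP => [->|]; rewrite ?vU //= andNb.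
rewrite [vneg _ _]vsum1 -zU.
have := @vsumU1 _ _ z (U :\ v) v; rewrite !inE eqxx setD1K // => /(_ isT).
lra.
Qed.

(** A point of the base polytope has a total of at most [- l^-(V \ U)] and its
    negative coordinates are bounded by [l^-]. *)
Lemma base_norm_le U z : f V <= 0 -> U \subset V -> in_base U h z ->
  base_norm U h <= - 2 * vneg l V.
Proof.
move=> fV UV zB; apply: ge_sup; first by exists (\sum_(v in U) `|z v|), z.
move=> _ [g gB ->]; under eq_bigr do rewrite normE.
rewrite sumrB -mulr_sumr -/(vsum g U) -/(vneg g U).
have [_ ->] := gB.
have := fdown_gain UV (subxx _); rewrite fdownV.
have : vneg l U <= vneg g U.
  apply: ler_sum => v vU; rewrite le_min ge_min lexx /=.
  exact: base_ge_ell gB vU.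
have := vnegD l UV; have := vneg_le0 l (V :\: U).
lra.
Qed.

End RingFamily.

(** * Convex combinations of bases *)

Section ConvexCombinations.
Variables (R : realType) (N : finType).
Variables (V : {set N}) (h : {set N} -> R) (k : nat) (x : 'I_k -> R).
Implicit Types (y : N -> R) (g : 'I_k -> N -> R).
Hypothesis x_ge0 : forall i, 0 <= x i.
Hypothesis x_sum : \sum_i x i = 1.

Lemma vsum_convex g y (S : {set N}) : S \subset V ->
  {in V, forall v, y v = \sum_i x i * g i v} ->
  vsum y S = \sum_i x i * vsum (g i) S.
Proof.
move=> SV yE; rewrite /vsum.
under eq_bigr => v vS do rewrite yE ?(subsetP SV) //.
by rewrite exchange_big; apply: eq_bigr => i _; rewrite mulr_sumr.
Qed.

Lemma convex_in_base g y : (forall i, in_base V h (g i)) ->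
  {in V, forall v, y v = \sum_i x i * g i v} -> in_base V h y.
Proof.
move=> gB yE; split=> [S SV|]; rewrite (vsum_convex _ yE) //.
  rewrite -[h S]mul1r -x_sum mulr_suml; apply: ler_sum => i _.
  by apply: ler_wpM2l => //; apply: (gB i).1.
rewrite -[h V]mul1r -x_sum mulr_suml; apply: eq_bigr => i _.
by rewrite (gB i).2.
Qed.

Lemma exchange_in_base g (j : 'I_k) (g' y y' : N -> R) :
  (forall i, in_base V h (g i)) -> in_base V h g' ->
  {in V, forall v, y v = \sum_i x i * g i v} ->
  {in V, forall v, y' v = y v + x j * (g' v - g j v)} -> in_base V h y'.
Proof.
move=> gB gB' yE y'E.
apply: (@convex_in_base (fun i => if i == j then g' else g i)).
  by move=> i; case: eqP.
move=> v vV; rewrite y'E // yE // (bigD1 j) //= [RHS](bigD1 j) //= eqxx.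
rewrite [in RHS](eq_bigr (fun i => x i * g i v)); first by ring.
by move=> i /negPf ->.
Qed.

End ConvexCombinations.

(** * Certificates obtained from a point of the base polytope *)

Section Certificates.
Variables (R : realType) (N : finType).
Variables (V : {set N}) (f : {set N} -> R) (F : {set N * N}).
Hypothesis taF : transitive_acyclic V F.
Hypothesis subf : submodular_on V f.
Implicit Types (X Y S U W : {set N}) (v z : N) (y g : N -> R).

Definition minimizer (U : {set N}) (h : {set N} -> R) X :=
  X \subset U /\ forall Y, Y \subset U -> h X <= h Y.

Local Notation l := (ell V f F).
Local Notation h := (fdown V f F).

Let sF : F \subset setX V V. Proof. by case: taF. Qed.

(** A minimizer [X] has [h X <= h W], whereas [h X >= y^-(X)]: if [W] is nearly
    tight for [y], the negative part of [y] outside [X] is nearly zero. *)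
Lemma very_negative_forced y W X v eps :
  in_base V h y -> W \subset V -> h W <= vneg y V + eps ->
  minimizer V f X -> down_closed F X -> v \in V -> y v < - eps -> v \in X.
Proof.
move=> [yB _] WV hW [XV minX] clX vV yv; apply/negPn/negP => vX.
have := yB X XV; rewrite fdown_closed // => yX.
have := minX _ (down_set_sub sF WV); have := fdown_ge V f F W.
have := vnegD y XV; have := vneg_le_vsum y X.
have : vneg y (V :\: X) <= vneg y [set v].
  by apply: vneg_sub; rewrite sub1set inE vX.
have : vneg y [set v] <= vsum y [set v] by exact: vneg_le_vsum.
rewrite vsum1; lra.
Qed.

(** A closed set containing [v] but not [z] lies in [V \ z^up]; there the
    coordinate [y v] outweighs all negative ones, so [f] is positive on it. *)
Lemma large_coordinate_arc y X v z :
  in_base V h y -> f set0 = 0 -> minimizer V f X -> down_closed F X ->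
  v \in V :\: up F z -> - vneg y (V :\: up F z) < y v -> v \in X -> z \in X.
Proof.
move=> [yB _] f0 [XV minX] clX vS yv vX; apply/negPn/negP => zX.
have XS := closed_sub_diff_up XV clX zX.
have := yB X XV; rewrite fdown_closed //.
have := minX _ (sub0set V); rewrite f0.
have := @vsumU1 _ _ y (X :\ v) v; rewrite !inE eqxx setD1K // => /(_ isT) ->.
have := vneg_le_vsum y (X :\ v).
have : vneg y (V :\: up F z) <= vneg y (X :\ v).
  by apply: vneg_sub; apply: subset_trans XS; apply: subD1set.
lra.
Qed.

(** If [f] is large on [S] compared with the negative part of [y], moving the
    best of the [k] bases to one that is tight on [S] raises [y(S)] by at least
    [(f S - y S) / k] while decreasing no coordinate in [S]; were all
    coordinates of [y'] in [S] at most [- y'^-(S)], then [y'(S)] would be too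
    small. *)
Lemma exists_large_coordinate k (x : 'I_k -> R) (g : 'I_k -> N -> R)
    (j : 'I_k) (g' y y' : N -> R) S :
  (forall i, 0 <= x i) -> S \subset V -> (0 < #|V|)%N ->
  {in V, forall v, y v = \sum_i x i * g i v} ->
  \sum_i x i = 1 ->
  - 2 * k%:R * #|V|%:R * vneg y S < f S ->
  (forall i, x i * (f S - vsum (g i) S) <= x j * (f S - vsum (g j) S)) ->
  vsum g' S = f S -> {in S, forall v, g j v <= g' v} ->
  {in V, forall v, y' v = y v + x j * (g' v - g j v)} ->
  exists2 v, v \in S & - vneg y' S < y' v.
Proof.
move=> x0 SV V0 yE x1 bigf bestj g'S g'ge y'E.
have [/exists_inP//|/exists_inPn small] :=
  boolP [exists v in S, - vneg y' S < y' v].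
have {}small : {in S, forall v, y' v <= - vneg y' S}.
  by move=> v /small; rewrite -leNgt.
have y'S : vsum y' S = vsum y S + x j * (f S - vsum (g j) S).
  rewrite -g'S /vsum -sumrB mulr_sumr -big_split /=; apply: eq_bigr => v vS.
  by rewrite y'E ?(subsetP SV).
have neg_le : vneg y S <= vneg y' S.
  apply: ler_vneg => v vS; rewrite y'E ?(subsetP SV) // lerDl mulr_ge0 //.
  by rewrite subr_ge0 g'ge.
have gain : f S - vsum y S <= k%:R * (x j * (f S - vsum (g j) S)).
  rewrite (vsum_convex SV yE) -[f S]mul1r -{1}x1 mulr_suml -sumrB.
  under eq_bigr do rewrite -mulrBr.
  rewrite mulr_natl -[k in _ *+ k]card_ord -sumr_const.
  by apply: ler_sum => i _; rewrite mul1r; apply: bestj.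
have k1 : 1 <= k%:R :> R by rewrite ler1n (leq_trans _ (ltn_ord j)).
have n1 : 1 <= #|V|%:R :> R by rewrite ler1n.
have ySge := vneg_le_vsum y S.
have M0 : 0 <= - vneg y' S by rewrite oppr_ge0 vneg_le0.
have y'le : vsum y' S <= #|V|%:R * - vneg y' S.
  apply: le_trans (vsum_le_card small) _.
  by apply: ler_wpM2r => //; rewrite ler_nat subset_leq_card.
move: M0 neg_le y'le gain ySge bigf; rewrite y'S.
set M' := vneg y' S; set M := vneg y S; set K := k%:R; set m := #|V|%:R.
set d := x j * _; set a := f S; set Y := vsum y S.
move=> M0 neg_le y'le gain ySge bigf.
have e1 : K * (Y + d) <= K * (m * - M).
  apply: ler_wpM2l; first by lra.
  apply: le_trans y'le _; apply: ler_wpM2l; lra.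
have e2 : (K - 1) * M <= (K - 1) * Y by apply: ler_wpM2l => //; lra.
have e3 : K * - M <= K * m * - M.
  apply: ler_wpM2r; first by lra.
  by rewrite ler_peMr //; lra.
have : K * (m * - M) = K * m * - M by ring.
have : - 2 * K * m * M = 2 * (K * m * - M) by ring.
lra.
Qed.

(** On [V \ z^up] the function [f] is small, and adding [z] changes it by
    [ell z]; were no coordinate of [y] below [- tau], then [y] would bound the
    result from below and this change could not be very negative. *)
Lemma ell_ge_of_failed_test k y z tau :
  in_base V h y -> z \in V -> 0 <= tau ->
  f (V :\: up F z) <= - 2 * k%:R * #|V|%:R * vneg y (V :\: up F z) ->
  {in V, forall v, - tau <= y v} ->
  - (tau * ((2 * k%:R * #|V|%:R + 1) * #|V|%:R + 1)) <= l z.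
Proof.
move=> [yB _] zV tau0 smallf yge; set S := V :\: up F z.
have SV : S \subset V by apply: subsetDl.
have zSV : z |: S \subset V by rewrite subUset sub1set zV.
have := yB _ zSV; rewrite fdown_closed; last exact: add_min_closed taF zV.
rewrite vsumU1 ?inE ?connect0 // /ell -/S.
have := yge _ zV; have := vneg_le_vsum y S.
have neg : - (#|V|%:R * tau) <= vneg y S.
  apply: le_trans (vneg_ge_card tau0 _); last first.
    by move=> v /(subsetP SV); apply: yge.
  by rewrite lerN2 ler_wpM2r // ler_nat subset_leq_card.
move: smallf; rewrite -/S; set m := #|V|%:R in neg *; set K := k%:R.
have Km : 0 <= 2 * K * m by rewrite !mulr_ge0 ?ler0n.
have : (2 * K * m) * - (m * tau) <= (2 * K * m) * vneg y S by exact: ler_wpM2l.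
have : - 2 * K * m * vneg y S = - (2 * K * m * vneg y S) by ring.
have : tau * ((2 * K * m + 1) * m + 1) = 2 * K * m * (m * tau) + m * tau + tau.
  by ring.
lra.
Qed.

Lemma ell_nonneg_min0 X : f set0 = 0 -> 0 <= vneg l V -> X \subset V ->
  down_closed F X -> 0 <= f X.
Proof.
move=> f0 lV XV clX.
have c0 : down_closed F set0 by move=> u v _; rewrite inE.
have := potential_mono taF subf (sub0set X) XV c0 clX.
rewrite f0 [vneg _ set0]vsum0; have := vneg_sub l XV; lra.
Qed.

(** The certificate of the oracle on [U] is one on [V] as well: outside [U] the
    coordinates of [y] are at least [- tau], and all elements of the base
    polytope have [l_1]-norm at most [- 2 ell^-(V)]. *)
Lemma extended_certificate y ybar U W tau d :
  f V <= 0 -> U \subset V -> in_base V h y -> in_base U h ybar ->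
  {in U, y =1 ybar} -> 0 <= tau -> 0 <= d ->
  {in V :\: U, forall v, - tau <= l v} ->
  h W <= vneg ybar U + d * base_norm U h ->
  h W <= vneg y V + (#|V|%:R * tau - 2 * d * vneg l V).
Proof.
move=> fV UV yB ybB eqy tau0 d0 lge hW; apply: le_trans hW _.
have := base_norm_le taF subf fV UV ybB => /(ler_wpM2l d0).
rewrite (vnegD y UV) (eq_vneg eqy).
have : - (#|V|%:R * tau) <= vneg y (V :\: U).
  apply: le_trans (vneg_ge_card tau0 _).
    by rewrite lerN2 ler_wpM2r // ler_nat subset_leq_card // subsetDl.
  move=> v vVU; have vV : v \in V by move: vVU; rewrite inE => /andP[].
  apply: le_trans (base_ge_ell taF subf (subxx V) yB vV).
  by rewrite le_min oppr_le0 tau0 lge.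
lra.
Qed.

End Certificates.

Lemma exists_minimizer (R : realType) (N : finType) (U : {set N})
  (h : {set N} -> R) : exists X, minimizer U h X.
Proof.
have [X XU minX] := @arg_minP _ _ _ set0 (fun X => X \subset U) h (sub0set U).
by exists X.
Qed.

(** * Values and costs of the subroutines *)

Section Folds.
Variables (R : realType) (A B : Type).
Implicit Types (k : B -> A -> costed R B) (s : seq A).

Lemma foldM_nil k b : foldM k b [::] = ret R b.
Proof. by []. Qed.

Lemma foldM_cons k b a s :
  foldM k b (a :: s) = bind (k b a) (fun b' => foldM k b' s).
Proof. by []. Qed.

Lemma foldM_val k b s : (foldM k b s).1 = foldl (fun b a => (k b a).1) b s.
Proof. by elim: s b => //= a s IH b; rewrite IH. Qed.

Lemma foldM_cost k b s c : (forall b a, (k b a).2 <= c) ->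
  (foldM k b s).2 <= (size s)%:R * c.
Proof.
move=> kc; elim: s b => [|a s IH] b /=; first by rewrite mul0r.
by rewrite -natr1 mulrDl mul1r addrC lerD.
Qed.

Lemma foldl_sum (G : A -> R) b s :
  foldl (fun a v => a + G v) b s = b + \sum_(v <- s) G v.
Proof.
elim: s b => [|v s IH] b /=; first by rewrite big_nil addr0.
by rewrite IH big_cons addrA.
Qed.

End Folds.

Definition term0 (R : realType) (N : finType) : wterm R N :=
  WTerm 0 [::] (fun=> 0).

Section Subroutines.
Variables (R : realType) (N : finType) (enumS : {set N} -> seq N).
Hypothesis enumP : forall S, ordering S (enumS S).
Implicit Types (X S V A : {set N}) (z : N -> R) (s : seq N) (v : N).
Implicit Types (ev : evaluator R N) (F : {set N * N}).
Local Notation term ts := (nth (term0 R N) ts).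

Let size_enumS S : size (enumS S) = #|S|.
Proof. exact/ordering_size/enumP. Qed.

Lemma sum_enumS (G : N -> R) S : \sum_(v <- enumS S) G v = \sum_(v in S) G v.
Proof. by rewrite (perm_big _ (enumP S)) big_enum. Qed.

Lemma vsumM_val z S : (vsumM enumS z S).1 = vsum z S.
Proof. by rewrite /vsumM foldM_val foldl_sum add0r sum_enumS. Qed.

Lemma vsumM_cost z S : (vsumM enumS z S).2 <= #|S|%:R.
Proof.
rewrite -size_enumS -[leRHS]mulr1; exact: foldM_cost.
Qed.

Lemma vnegM_val z S : (vnegM enumS z S).1 = vneg z S.
Proof. by rewrite /vnegM foldM_val /= foldl_sum add0r sum_enumS. Qed.

Lemma vnegM_cost z S : (vnegM enumS z S).2 <= #|S|%:R * 2.
Proof. by rewrite -size_enumS; apply: foldM_cost => a v /=; lra. Qed.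

Lemma tabulateM_val (e : N -> costed R R) s v : v \in s ->
  (tabulateM e s).1 v = (e v).1.
Proof.
rewrite /tabulateM foldM_val /=.
have gen z0 : foldl (fun z u => upd z u (e u).1) z0 s v
    = if v \in s then (e v).1 else z0 v.
  elim: s z0 => //= u s IH z0; rewrite IH inE /upd.
  by case: (v \in s); rewrite ?orbT ?orbF //; case: eqP => // ->.
by move=> vs; rewrite gen vs.
Qed.

Lemma tabulateM_cost (e : N -> costed R R) s c : (forall v, (e v).2 <= c) ->
  (tabulateM e s).2 <= (size s)%:R * c.
Proof. by move=> ec; apply: foldM_cost => z v /=; rewrite addr0. Qed.

Lemma filterM_val (p : N -> costed R bool) S :
  (filterM enumS p S).1 = [set v in S | (p v).1].
Proof.
rewrite /filterM foldM_val /=; apply/setP => v; rewrite inE.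
have gen X s : (v \in foldl (fun Y u => if (p u).1 then u |: Y else Y) X s)
    = (v \in X) || (v \in s) && (p v).1.
  elim: s X => [|u s IH] X /=; first by rewrite orbF.
  rewrite IH inE; case: (eqVneq v u) => [->|vu] /=.
    by case: ifP => pu; rewrite ?inE ?eqxx ?andbT ?andbF ?orbF //= orbT.
  by case: ifP => // pu; rewrite !inE (negPf vu).
by rewrite gen inE (ordering_mem (enumP S)).
Qed.

Lemma filterM_cost (p : N -> costed R bool) S c : (forall v, (p v).2 <= c) ->
  (filterM enumS p S).2 <= #|S|%:R * c.
Proof.
by move=> pc; rewrite -size_enumS; apply: foldM_cost => z v /=; rewrite addr0.
Qed.

Lemma ellM_val V ev F :
  {in V, (ellM enumS V ev F).1 =1 ell V (fun X => (ev X).1) F}.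
Proof. by move=> v vV; rewrite tabulateM_val ?(ordering_mem (enumP V)). Qed.

Section EvaluationCost.
Variables (ev : evaluator R N) (E : R).
Hypothesis evE : forall X, (ev X).2 <= E.

Lemma ellM_cost V F : (ellM enumS V ev F).2 <= #|V|%:R * (2 * E + 1).
Proof.
rewrite -size_enumS; apply: tabulateM_cost => v /=.
have := evE (v |: (V :\: up F v)); have := evE (V :\: up F v); lra.
Qed.

Lemma fdownM_cost V F (l : N -> R) X : F \subset setX V V ->
  (fdownM enumS ev F l X).2 <= E + #|V|%:R * 2 + 1.
Proof.
move=> sF /=; have := evE (down_set F X).
have sXV : down_set F X :\: X \subset V.
  rewrite subDset; apply: down_set_min; last exact: subsetUl.
  move=> u v uv _; have := subsetP sF _ uv.
  by rewrite !inE => /andP[_ ->]; rewrite orbT.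
have := vnegM_cost l (down_set F X :\: X).
have : #|down_set F X :\: X|%:R * 2 <= #|V|%:R * 2 :> R.
  by rewrite ler_wpM2r // ler_nat subset_leq_card.
lra.
Qed.

Lemma greedyM_cost X s :
  (greedyM ev X s).2 <= E + (size s)%:R * (E + 1).
Proof.
rewrite /greedyM /= addr0; apply: lerD => //; apply: foldM_cost.
by move=> [[A a] g] v /=; have := evE (v |: A); lra.
Qed.

End EvaluationCost.

Lemma fdownM_val V ev F (l : N -> R) X : F \subset setX V V -> X \subset V ->
  {in V, l =1 ell V (fun X => (ev X).1) F} ->
  (fdownM enumS ev F l X).1 = fdown V (fun X => (ev X).1) F X.
Proof.
move=> sF XV eql; rewrite /= vnegM_val /fdown; congr (_ - _).
apply: eq_vneg => v; rewrite inE => /andP[_ vD].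
exact/eql/(subsetP (down_set_sub sF XV)).
Qed.

Lemma greedyM_val ev A s v : uniq s -> v \in s ->
  let p := A :|: [set u in take (index v s) s] in
  (greedyM ev A s).1 v = (ev (v |: p)).1 - (ev p).1.
Proof.
rewrite /greedyM /= foldM_val.
have gen g : uniq s ->
  (foldl (fun st u => (let: (A', a, g') := st in
     let* b := ev (u |: A') in let* x := subM b a in
     ret R (u |: A', b, upd g' u x)).1) (A, (ev A).1, g) s).2 v
  = if v \in s then (ev (v |: (A :|: [set u in take (index v s) s]))).1
                    - (ev (A :|: [set u in take (index v s) s])).1 else g v.
  elim: s A g => [|u s IH] A' g //= /andP[us uniqs].
  rewrite IH // inE [u == v]eq_sym.
  have [->|vu] := eqVneq v u; rewrite /=.
    rewrite (negPf us) /upd eqxx (_ : [set u in [::]] = set0) ?setU0 //.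
  rewrite /upd (negPf vu).
  suff -> : A' :|: [set w in u :: take (index v s) s]
          = u |: A' :|: [set w in take (index v s) s] by [].
  by apply/setP => w; rewrite !inE orbCA orbA.
by move=> us vs; rewrite gen // vs.
Qed.

Lemma greedyM0_val ev s v : uniq s -> v \in s ->
  (greedyM ev set0 s).1 v = extreme_base (fun X => (ev X).1) s v.
Proof. by move=> us vs; rewrite greedyM_val // set0U. Qed.

Lemma eq_extreme_base V (h h' : {set N} -> R) s v : {subset s <= V} ->
  v \in s -> (forall X, X \subset V -> h X = h' X) ->
  extreme_base h s v = extreme_base h' s v.
Proof.
move=> sV vs eqh.
have pV : [set u in take (index v s) s] \subset V.
  by apply/subsetP => u; rewrite inE => /mem_take/sV.
by rewrite /extreme_base !eqh // subUset sub1set sV.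
Qed.

Lemma best_termM_val a S (ts : seq (wterm R N)) : ts <> [::] ->
  exists2 j, (j < size ts)%N &
    (best_termM enumS a S ts).1 = Some (term ts j) /\
    forall i, (i < size ts)%N ->
      coef (term ts i) * (a - vsum (base_of (term ts i)) S)
      <= coef (term ts j) * (a - vsum (base_of (term ts j)) S).
Proof.
pose w (t : wterm R N) := coef t * (a - vsum (base_of t) S).
rewrite /best_termM /= foldM_val; set stepf := (fun b t => fst _).
have stepE b t : stepf b t =
    if b is Some (q, _) then (if q < w t then Some (w t, t) else b)
    else Some (w t, t).
  by rewrite /stepf /w -vsumM_val; case: b => [[q t']|].
move=> ts0.
suff [j jts [-> H]] : exists2 j, (j < size ts)%N &
    foldl stepf None ts = Some (w (term ts j), term ts j) /\
    forall i, (i < size ts)%N -> w (term ts i) <= w (term ts j).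
  by exists j.
elim/last_ind: ts ts0 => // ts t IH _; rewrite foldl_rcons size_rcons stepE.
have nth_old i : (i < size ts)%N -> term (rcons ts t) i = term ts i.
  by move=> ilt; rewrite nth_rcons ilt.
have nth_new : term (rcons ts t) (size ts) = t.
  by rewrite nth_rcons ltnn eqxx.
case: ts IH nth_old nth_new => [|t0 ts] IH nth_old nth_new.
  by exists 0%N => //; split=> // i; rewrite ltnS leqn0 => /eqP ->.
have [//|j jlt [-> maxj]] := IH.
case: ltP => wlt.
  exists (size (t0 :: ts)) => //; rewrite nth_new; split=> // i.
  rewrite ltnS leq_eqVlt => /predU1P[->|ilt]; first by rewrite nth_new.
  by rewrite nth_old //; apply: le_trans (maxj i ilt) (ltW wlt).
exists j; first exact: ltnW.
rewrite nth_old //; split=> // i.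
rewrite ltnS leq_eqVlt => /predU1P[->|ilt]; first by rewrite nth_new.
by rewrite nth_old // maxj.
Qed.

Lemma best_termM_cost a S (ts : seq (wterm R N)) :
  (best_termM enumS a S ts).2 <= (size ts)%:R * (#|S|%:R + 3).
Proof.
rewrite /best_termM /= addr0; apply: foldM_cost => b t.
have := vsumM_cost (base_of t) S.
by case: b => [[q t']|] /=; lra.
Qed.

End Subroutines.

(** * The search for the active level *)

Section Levels.
Variables (R : realType) (N : finType) (enumS : {set N} -> seq N).
Hypothesis enumP : forall S, ordering S (enumS S).
Variables (V : {set N}) (l : N -> R) (l2 Q : R).

Definition level (t : nat) : {set N} := [set v in V | l v <= l2 / Q ^+ t].

Lemma levelM_val fuel t : exists b,
  [/\ (t <= b <= t + fuel)%N,
      (levelM enumS V l l2 Q fuel (level t) (Q ^+ t)).1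
        = (level b.+1, Q ^+ b.+1),
      (#|level b.+1| <= 2 * #|level b|)%N \/ b = (t + fuel)%N &
      forall i, (t <= i < b)%N -> (2 * #|level i| < #|level i.+1|)%N].
Proof.
elim: fuel t => [|fuel IH] t.
  exists t; split; rewrite ?addn0 ?leqnn //; last 2 first.
  - by right.
  - by move=> i /andP[/leq_ltn_trans H /H]; rewrite ltnn.
  by rewrite /= filterM_val // -exprSr; case: ifP.
have -> : (levelM enumS V l l2 Q fuel.+1 (level t) (Q ^+ t)).1
    = if (#|level t.+1| <= 2 * #|level t|)%N then (level t.+1, Q ^+ t.+1)
      else (levelM enumS V l l2 Q fuel (level t.+1) (Q ^+ t.+1)).1.
  rewrite /= filterM_val //= -exprSr -/(level t.+1) -natrM ler_nat.
  by case: leqP.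
case: leqP => [stop|grow].
  exists t; split; rewrite ?leqnn ?leq_addr //; first by left.
  by move=> i /andP[/leq_ltn_trans H /H]; rewrite ltnn.
have [b [/andP[tb bf] vE stop grows]] := IH t.+1.
exists b; split; rewrite ?(ltnW tb) ?addnS -?addSn ?bf //.
move=> i /andP[]; rewrite leq_eqVlt => /predU1P[<- //|ti ib].
by apply: grows; rewrite ti.
Qed.

Lemma levelM_cost fuel A q :
  (levelM enumS V l l2 Q fuel A q).2 <= (fuel.+1)%:R * (#|V|%:R + 4).
Proof.
elim: fuel A q => [|fuel IH] A q /=.
  have := @filterM_cost _ _ _ enumP (fun v => leM (l v) (l2 / (q * Q))) V 1.
  move=> /(_ (fun=> lexx _)).
  by case: ifP => _ /=; lra.
have := @filterM_cost _ _ _ enumP (fun v => leM (l v) (l2 / (q * Q))) V 1.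
move=> /(_ (fun=> lexx _)).
have m0 : 0 <= #|V|%:R :> R by rewrite ler0n.
have f0 : 0 <= fuel%:R * #|V|%:R :> R by rewrite mulr_ge0 ?ler0n.
have f0' : 0 <= fuel%:R :> R by rewrite ler0n.
case: ifP => _ /=.
  rewrite -[fuel.+2%:R]natr1 -[fuel.+1%:R]natr1; lra.
set A' := (foldM _ _ _).1; have := IH A' (q * Q).
rewrite -[fuel.+2%:R]natr1; lra.
Qed.

(** While the search goes on the level sets more than double, so it stops after
    logarithmically many steps.  It cannot stop at once: level 0 is empty, as
    no [l v] is below the sum of all negative ones, but level 1 is not, as the
    most negative [l v] is at most the average. *)
Lemma level_search : l2 = 2 * vneg l V -> vneg l V < 0 ->
  2 * #|V|%:R < Q -> exists b,
  [/\ (levelM enumS V l l2 Q #|V| (level 0) 1).1 = (level b.+1, Q ^+ b.+1),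
      (#|level b.+1| <= 2 * #|level b|)%N,
      level b != set0 &
      exists2 p, b = p.+1 & (2 ^ p <= #|V|)%N].
Proof.
move=> l2E lneg Qbig.
have level0 : level 0 = set0.
  apply/setP => v; rewrite !inE expr0 divr1; apply/negbTE.
  rewrite negb_and -implybE; apply/implyP => vV; rewrite -ltNge l2E.
  have : vneg l V <= vneg l [set v] by apply: vneg_sub; rewrite sub1set.
  have : vneg l [set v] <= vsum l [set v] by exact: vneg_le_vsum.
  rewrite vsum1; lra.
have V0 : (0 < #|V|)%N.
  rewrite lt0n; apply: contraTN lneg => /eqP/cards0_eq ->.
  by rewrite [vneg _ _]vsum0 ltxx.
have level1 : (0 < #|level 1|)%N.
  rewrite lt0n; apply/eqP => /cards0_eq l1.
  have Q0 : 0 < Q by apply: le_lt_trans Qbig; rewrite mulr_ge0 ?ler0n.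
  have thr0 : 0 <= - (l2 / Q).
    by rewrite oppr_ge0 pmulr_lle0 ?invr_gt0 // l2E; lra.
  have := vneg_ge_card (X := V) (z := l) thr0; rewrite opprK mulrN opprK.
  move=> avg; have {}avg : #|V|%:R * (l2 / Q) <= vneg l V.
    apply: avg => v vV.
    rewrite leNgt; apply/negP => lv.
    by have := in_set0 v; rewrite -l1 inE vV expr1 ltW.
  by move: avg; rewrite mulrA ler_pdivrMr // l2E; nra.
have [b [/andP[_ bV] vE stop grows]] := levelM_val #|V| 0.
rewrite expr0 in vE.
have grow p : (p < b)%N -> (2 ^ p <= #|level p.+1|)%N.
  elim: p => [|p IH] pb; first by rewrite expn0.
  apply: leq_trans (ltnW (grows p.+1 _)); last by rewrite pb.
  by rewrite expnS leq_mul2l IH // ltnW.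
have levelV p : (#|level p| <= #|V|)%N.
  by apply/subset_leq_card/subsetP => v; rewrite inE => /andP[].
have stopb : (#|level b.+1| <= 2 * #|level b|)%N.
  case: stop => // bE; rewrite bE add0n.
  have := levelV (#|V|).+1; have := grow #|V|.-1.
  rewrite prednK // bE add0n => /(_ (leqnn _)) H1 H2.
  apply: leq_trans H2 _; apply: leq_trans (ltnW (ltn_expl #|V| (ltnSn 1))) _.
  by rewrite -{1}(prednK V0) expnS leq_mul2l.
case: b => [|p] in vE stopb grow stop bV grows *.
  by move: stopb; rewrite level0 cards0 muln0 leqNgt level1.
exists p.+1; split=> //.
  by rewrite -card_gt0; apply: leq_trans (grow p _) => //; rewrite expn_gt0.
by exists p => //; apply: leq_trans (levelV p.+1); apply: grow.
Qed.

End Levels.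

(** * The new arcs of an iteration *)

Section Decompositions.
Variables (R : realType) (N : finType).
Implicit Types (U V : {set N}) (h : {set N} -> R) (y : N -> R).
Implicit Types (ts : seq (wterm R N)).
Local Notation term ts := (nth (term0 R N) ts).

Definition decomposition V h y ts :=
  [/\ \sum_(t <- ts) coef t = 1,
      forall i, (i < size ts)%N -> let t := term ts i in
        [/\ 0 <= coef t, ordering V (order_of t) &
            {in V, base_of t =1 extreme_base h (order_of t)}] &
      {in V, forall v, y v = \sum_(t <- ts) coef t * base_of t v}].

Lemma sum_terms (G : wterm R N -> R) ts :
  \sum_(t <- ts) G t = \sum_(i < size ts) G (term ts i).
Proof. by rewrite (big_nth (term0 R N)) big_mkord. Qed.

Lemma decomposition_nonempty V h y ts : decomposition V h y ts -> ts <> [::].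
Proof.
by case=> + _ _ ts0; rewrite ts0 big_nil => /esym/eqP; rewrite oner_eq0.
Qed.

Lemma eq_in_base V h z g : {in V, z =1 g} -> in_base V h z -> in_base V h g.
Proof.
move=> eqz [zle zV]; split=> [S SV|]; last by rewrite -zV; apply/esym/eq_vsum.
rewrite -(eq_vsum (z := z)); first exact: zle.
by move=> v /(subsetP SV); apply: eqz.
Qed.

Lemma term_in_base V h y ts i : submodular_on V h -> h set0 = 0 ->
  decomposition V h y ts -> (i < size ts)%N ->
  in_base V h (base_of (term ts i)).
Proof.
move=> subh h0 [_ tsP _] /tsP[_ ord_t base_t].
apply: eq_in_base (extreme_base_in_base subh h0 ord_t).
by move=> v vV; rewrite base_t.
Qed.

Lemma decomposition_in_base V h y ts : submodular_on V h -> h set0 = 0 ->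
  decomposition V h y ts -> in_base V h y.
Proof.
move=> subh h0 dec; have [sum1 tsP yE] := dec; rewrite sum_terms in sum1.
apply: (convex_in_base _ sum1 (g := fun i => base_of (term ts i))).
- by move=> i; have [] := tsP i (ltn_ord i).
- by move=> i; apply: term_in_base dec _.
- by move=> v vV; rewrite yE // sum_terms.
Qed.

(** Every term is prolonged by the same ordering [vs] of [V \ U], so outside [U]
    all of them, and their convex combination, have the same coordinates. *)
Lemma extend_decomposition U V h y ts vs (e : N -> R) : U \subset V ->
  ordering (V :\: U) vs ->
  {in V :\: U, forall v, let p := U :|: [set u in take (index v vs) vs] in
     e v = h (v |: p) - h p} ->
  decomposition U h y ts ->
  let extend (z : N -> R) := fun v => if v \in U then z v else e v in
  decomposition V h (extend y)
    [seq WTerm (coef t) (order_of t ++ vs) (extend (base_of t)) | t <- ts].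
Proof.
move=> UV ovs eE [sum1 tsP yE] extend; split.
- by rewrite big_map.
- move=> i; rewrite size_map => ilt; rewrite (nth_map (term0 R N)) //=.
  have [x0 ot bt] := tsP i ilt; set t := nth _ _ _ in x0 ot bt *.
  have mt := ordering_mem ot; split=> //.
    apply: orderingP => [|v]; last first.
      rewrite mem_cat mt (ordering_mem ovs) inE.
      by have [/(subsetP UV)->|] := boolP (v \in U).
    rewrite cat_uniq (ordering_uniq ot) (ordering_uniq ovs) andbT /=.
    by apply/hasPn => v; rewrite (ordering_mem ovs) inE /= mt => /andP[].
  move=> v vV; rewrite /extend; case: ifPn => vU.
    by rewrite extreme_base_cat ?mt // bt.
  rewrite eE ?inE ?vU //= /extreme_base index_cat mt (negPf vU).
  rewrite take_cat ltnNge leq_addr /= addKn.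
  suff -> : [set u in order_of t ++ take (index v vs) vs]
          = U :|: [set u in take (index v vs) vs] by [].
  by apply/setP => u; rewrite !inE mem_cat mt.
move=> v vV; rewrite big_map /extend /=.
case vU: (v \in U); first by rewrite yE.
by rewrite -mulr_suml sum1 mul1r.
Qed.

End Decompositions.

Local Opaque foldM vsumM vnegM tabulateM filterM ellM fdownM greedyM best_termM.

Section AddArcs.
Variables (R : realType) (V0 : finType).
Local Notation N := {set V0}.
Variable enumS : {set N} -> seq N.
Hypothesis enumP : forall S, ordering S (enumS S).
Variables (V : {set N}) (ev : evaluator R N) (F : {set N * N}) (l y : N -> R).
Variables (ts : seq (wterm R N)) (E : R).
Local Notation term ts := (nth (term0 R N) ts).
Local Notation f := (fun X => (ev X).1).
Local Notation h := (fdown V f F).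
Hypothesis taF : transitive_acyclic V F.
Hypothesis subf : submodular_on V f.
Hypothesis f0 : f set0 = 0.
Hypothesis lE : {in V, l =1 ell V f F}.
Hypothesis dec : decomposition V h y ts.
Hypothesis evE : forall X, (ev X).2 <= E.

Definition arc_test (z : N) : bool :=
  - 2 * (size ts)%:R * #|V|%:R * vneg y (V :\: up F z) < f (V :\: up F z).

(** What a push certifies about a new arc, and that the arc is new: its tail is
    not yet above its head. *)
Definition justified (a : N * N) :=
  [/\ a.2 \in V, a.1 \in V :\: up F a.2 &
      forall X, minimizer V f X -> down_closed F X -> a.1 \in X -> a.2 \in X].

Definition test_cost : R := E + #|V|%:R * 2 + 4.

Definition push_cost : R :=
  let Ed := E + #|V|%:R * 2 + 1 in
  (size ts)%:R * (#|V|%:R + 3) + (Ed + #|V|%:R * (Ed + 1)) + #|V|%:R * 6 + 1.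

(** The arcs of different heads [z] are found independently of each other, all
    from the same [y] and [F]; only the heads that pass the test cost a push,
    and each of them receives an arc. *)
Lemma add_arcsM_val_cost :
  let r := add_arcsM enumS V ev F l y ts in
  [/\ F \subset r.1,
      forall a, a \in r.1 -> a \in F \/ justified a,
      forall z, z \in V -> arc_test z ->
        exists2 v, v \in V :\: up F z & (v, z) \in r.1 &
      r.2 <= #|V|%:R * test_cost
             + #|[set z in V | arc_test z]|%:R * push_cost].
Proof.
have [sF _ _] := taF.
have subh := fdown_submodular taF subf.
have h0 : h set0 = 0 by rewrite fdown0.
have ts0 := decomposition_nonempty dec.
have [sum1 tsP yE] := dec.
have S_sub z : V :\: up F z \subset V by apply: subsetDl.
have cardS z : #|V :\: up F z|%:R <= #|V|%:R :> R.
  by rewrite ler_nat subset_leq_card.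
rewrite /add_arcsM; set k := (fun F' z => _).
have step F1 z : z \in V -> exists A : {set N},
    [/\ (k F1 z).1 = F1 :|: [set (v, z) | v in A],
        forall v, v \in A -> justified (v, z),
        arc_test z -> A != set0 &
        (k F1 z).2 <= test_cost + (arc_test z)%:R * push_cost].
  move=> zV; rewrite /k /= !vnegM_val // -/(arc_test z).
  have evS := evE (V :\: up F z).
  have yScost := vnegM_cost enumP y (V :\: up F z).
  have := cardS z; case: (boolP (arc_test z)) => /= [test|_] cS; last first.
    exists set0; rewrite imset0 setU0; split=> //= [v|]; first by rewrite inE.
    by rewrite /test_cost mul0r; lra.
  set S := V :\: up F z in evS yScost cS *.
  have [j jts [bestE bestj]] := best_termM_val enumP (f S) S ts0.
  have bestc := best_termM_cost enumP (f S) S ts.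
  have [x0j ordj basej] := tsP j jts.
  rewrite bestE /=; set t := term ts j in bestj x0j ordj basej *.
  set s := push_order (up F z) (order_of t).
  have ords : ordering V s by apply: push_ordering.
  have fdcost X := fdownM_cost enumP evE l X sF.
  have gcost := greedyM_cost fdcost set0 s.
  have gval v : v \in V ->
      (greedyM (fdownM enumS ev F l) set0 s).1 v = extreme_base h s v.
    move=> vV; rewrite greedyM0_val ?(ordering_mem ords) //.
      apply: (eq_extreme_base (V := V)); rewrite ?(ordering_mem ords) //.
        by move=> u; rewrite (ordering_mem ords).
      by move=> X XV; apply: fdownM_val.
    exact: ordering_uniq ords.
  set g := greedyM _ _ _ in gcost gval *.
  set e := (fun v => _) : N -> costed R R.
  have ecost v : (e v).2 <= 3 by rewrite /e /=; lra.
  have tabc := tabulateM_cost (enumS V) ecost.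
  have yval v : v \in V ->
      (tabulateM e (enumS V)).1 v = y v + coef t * (g.1 v - base_of t v).
    by move=> vV; rewrite tabulateM_val ?(ordering_mem (enumP V)).
  set y' := tabulateM _ _ in tabc yval *.
  rewrite filterM_val // vnegM_val //.
  have filc := @filterM_cost R _ _ enumP
    (fun v => ltM (0 - vneg y'.1 S) (y'.1 v)) S 1 (fun=> lexx _).
  have y'Sc := vnegM_cost enumP y'.1 S.
  set A := [set v in S | _].
  have Sclosed : down_closed F S by apply: diff_up_closed.
  have gB : in_base V h g.1.
    apply: eq_in_base (extreme_base_in_base subh h0 ords) => v vV.
    by rewrite gval.
  have y'B : in_base V h y'.1.
    pose gg (i : 'I_(size ts)) := base_of (term ts i).
    have jE : term ts (Ordinal jts) = t by [].
    apply: (@exchange_in_base _ _ V h _ (fun i => coef (term ts i)) _ _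
              gg (Ordinal jts) g.1 y).
    - by move=> i; have [] := tsP i (ltn_ord i).
    - by rewrite -sum1 sum_terms.
    - by move=> i; apply: term_in_base dec _.
    - by [].
    - by move=> v vV; rewrite yE // sum_terms.
    - by move=> v vV; rewrite yval.
  exists A; split=> //=.
  - move=> v; rewrite inE sub0r => /andP[vS yv]; split=> //= X minX clX.
    exact: (large_coordinate_arc y'B f0 minX clX vS yv).
  - move=> _; apply/set0Pn.
    suff [v vS yv] : exists2 v, v \in S & - vneg y'.1 S < y'.1 v.
      by exists v; rewrite inE vS sub0r.
    pose gg (i : 'I_(size ts)) := base_of (term ts i).
    apply: (@exists_large_coordinate _ _ V f _
              (fun i : 'I_(size ts) => coef (term ts i)) gg (Ordinal jts)
              g.1 y y'.1 S).
    + by move=> i; have [] := tsP i (ltn_ord i).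
    + exact: S_sub.
    + by apply/card_gt0P; exists z.
    + by move=> v vV; rewrite yE // sum_terms.
    + by rewrite -sum1 sum_terms.
    + exact: test.
    + by move=> i; apply: bestj.
    + rewrite (eq_vsum (g := extreme_base h s)).
        rewrite push_tight // fdown_closed //.
      by move=> v /(subsetP (S_sub z)); apply: gval.
    + move=> v vS; have vV := subsetP (S_sub z) v vS.
      by rewrite gval // /gg basej // (push_ge subh).
    + by move=> v vV; rewrite yval.
  - rewrite mul1r /test_cost /push_cost addr0.
    move: gcost tabc; rewrite (ordering_size ords) (ordering_size (enumP V)).
    have : (size ts)%:R * (#|S|%:R + 3) <= (size ts)%:R * (#|V|%:R + 3) :> R.
      by apply: ler_wpM2l => //; lra.
    lra.
clearbody k.
have main (s : seq N) (F1 : {set N * N}) :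
    {subset s <= V} -> F \subset F1 ->
    (forall a, a \in F1 -> a \in F \/ justified a) ->
  let r := foldM k F1 s in
  [/\ F1 \subset r.1,
      forall a, a \in r.1 -> a \in F \/ justified a,
      forall z, z \in s -> arc_test z ->
        exists2 v, v \in V :\: up F z & (v, z) \in r.1 &
      r.2 <= (size s)%:R * test_cost
             + (\sum_(z <- s) (arc_test z)%:R) * push_cost].
  elim: s F1 => [|z s IH] F1 sV FF1 F1P /=.
    by rewrite foldM_nil /= big_nil !mul0r addr0.
  have zV : z \in V by apply: sV; rewrite inE eqxx.
  have [A [kE AP A0 kcost]] := step F1 z zV.
  have [|||F2s F2P F2new cost] := IH (k F1 z).1.
  - by move=> v vs; apply: sV; rewrite inE vs orbT.
  - by rewrite kE; apply: subset_trans FF1 _; apply: subsetUl.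
  - move=> a; rewrite kE inE => /orP[/F1P //|/imsetP[v vA ->]].
    by right; apply: AP.
  rewrite foldM_cons /=.
  have kF2 : (k F1 z).1 \subset (foldM k (k F1 z).1 s).1 by [].
  split=> //.
  - by apply: subset_trans kF2; rewrite kE subsetUl.
  - move=> w; rewrite inE => /predU1P[->|]; last exact: F2new.
    move=> /A0/set0Pn[v vA]; have [_ vS _] := AP v vA.
    exists v => //; apply: (subsetP kF2); rewrite kE inE imset_f ?orbT //.
  - by rewrite big_cons -natr1 !mulrDl mul1r; lra.
have [|//||H1 H2 H3 H4] := main (enumS V) F.
- by move=> v; rewrite (ordering_mem (enumP V)).
- by left.
split=> //; first by move=> z zV; apply: H3; rewrite (ordering_mem (enumP V)).
move: H4; rewrite (ordering_size (enumP V)) sum_enumS // -natr_sum.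
by rewrite -big_mkcondr /= sum1dep_card.
Qed.

End AddArcs.

(** * Invariant of the states and contractions *)

Lemma setDU_id (T : finType) (X Y : {set T}) :
  X \subset Y -> (Y :\: X) :|: X = Y.
Proof.
move=> sXY; apply/setP => u; rewrite !inE; have := subsetP sXY u.
by case: (u \in X) => /= [->|_]; rewrite ?orbF.
Qed.

Section Contractions.
Variables (R : realType) (V0 : finType).
Local Notation N := {set V0}.
Variables (fO : {set V0} -> R) (EO : R) (enumS : {set N} -> seq N).
Hypothesis EO_ge0 : 0 <= EO.
Hypothesis enumP : forall S, ordering S (enumS S).
Implicit Types (s : state R V0) (X Y A : {set N}) (u v w : N).

Definition optimal X := forall Y : {set V0}, fO (cover X) <= fO Y.

Local Notation eval_bound := (EO + #|V0|%:R).

(** Capping the value of the whole ground set at 0 may turn it into a minimizer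
    when the minimum is 0; therefore only negative minimizers, and the empty
    set, are required to lift to optimal sets.  Contracting a down-set
    adds one subtraction to an evaluation and removes at least one node, which
    gives the bound on the evaluation cost. *)
Record sound s : Prop := Sound {
  sound_triv : trivIset (nodes s);
  sound_set0 : set0 \notin nodes s;
  sound_card : (#|nodes s| <= #|V0|)%N;
  sound_submodular : submodular_on (nodes s) (fval s);
  sound_fval0 : fval s set0 = 0;
  sound_fvalV : fval s (nodes s) <= 0;
  sound_arcs : arcs s \subset setX (nodes s) (nodes s);
  sound_irreflexive : irreflexive (arc (arcs s));
  sound_closed : forall X, minimizer (nodes s) (fval s) X ->
    down_closed (arcs s) X;
  sound_negative : forall X, minimizer (nodes s) (fval s) X ->
    fval s X < 0 -> optimal (X :|: taken s);
  sound_empty : minimizer (nodes s) (fval s) set0 -> optimal (taken s);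
  sound_cost : forall X,
    (evalf s X).2 <= EO + (#|V0|%:R - #|nodes s|%:R) }.

Definition forced s v := forall X, minimizer (nodes s) (fval s) X -> v \in X.

Lemma sound_cost_le s X : sound s -> (evalf s X).2 <= eval_bound.
Proof.
move=> snd; have := sound_cost snd X; have : 0 <= #|nodes s|%:R :> R by [].
lra.
Qed.

Lemma contract_down_nodes s v :
  nodes (contract_downM s v).1 = nodes s :\: down (arcs s) v.
Proof. by []. Qed.

Lemma contract_down_arcs s v : let V := nodes (contract_downM s v).1 in
  arcs (contract_downM s v).1 = arcs s :&: setX V V.
Proof. by []. Qed.

Section ContractDown.
Variables (s : state R V0) (v : N).
Hypothesis snd : sound s.
Hypothesis vV : v \in nodes s.
Hypothesis v_forced : forced s v.

Let V := nodes s.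
Let A := down (arcs s) v.
Let V' := V :\: A.
Let f := fval s.
Let f1 X := f (X :|: A) - f A.
Let f2 X := if X == V' then Num.min 0 (f1 V') else f1 X.
Let s' := (contract_downM s v).1.

Let AV : A \subset V.
Proof.
apply/subsetP => u; rewrite inE => vu.
exact: (down_closed_connect (ground_closed (sound_arcs snd)) vu vV).
Qed.

Let f2E : fval s' = f2.
Proof.
apply: boolp.funext => X; rewrite /s' /fval /contract_downM /= /f2 /f1.
by case: ifP.
Qed.

Let f2_le X : f2 X <= f1 X.
Proof. by rewrite /f2; case: eqP => // ->; rewrite ge_min lexx orbT. Qed.

Let f1_set0 : f1 set0 = 0.
Proof. by rewrite /f1 set0U subrr. Qed.

Let f2_set0 : f2 set0 = f1 set0.
Proof. by rewrite /f2; case: eqP => // <-; rewrite f1_set0 minxx. Qed.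

Let f2_neg X : f2 X < 0 -> f2 X = f1 X.
Proof.
rewrite /f2; case: eqP => // ->.
by case: (lerP 0 (f1 V')) => //; rewrite ltxx.
Qed.

(** Every minimizer contains [v] and is closed, hence contains all of [A]. *)
Let lift_minimizer X : minimizer V' f2 X -> f2 X = f1 X ->
  minimizer V f (X :|: A).
Proof.
move=> [XV' minX] eqX.
have [M [MV minM]] := exists_minimizer V f.
have AM : A \subset M.
  apply/subsetP => u; rewrite inE => vu.
  apply: (down_closed_connect _ vu); first exact: (sound_closed snd).
  exact: v_forced.
split=> [|Y YV].
  by rewrite subUset AV andbT; apply: subset_trans XV' (subsetDl _ _).
apply: le_trans (minM Y YV).
have := minX (M :\: A) (setSD A MV); have := f2_le (M :\: A).
rewrite eqX /f1 (setDU_id AM); lra.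
Qed.

(** Otherwise the empty set would be a minimizer, but it lacks [v]. *)
Let neg_lift X : minimizer V f X -> f X < 0.
Proof.
move=> minX; have := minX.2 _ (sub0set V).
rewrite {2}/f (sound_fval0 snd) le_eqVlt => /predU1P[fX|//].
have /v_forced : minimizer V f set0.
  by split=> [|Y YV]; rewrite ?sub0set // {1}/f (sound_fval0 snd) -fX minX.2.
by rewrite inE.
Qed.

Lemma contract_down_sound : sound s'.
Proof.
have V'V : V' \subset V by apply: subsetDl.
have sub1 : submodular_on V' f1.
  move=> X Y XV' YV'.
  have XA : X :|: A \subset V by rewrite subUset AV (subset_trans XV').
  have YA : Y :|: A \subset V by rewrite subUset AV (subset_trans YV').
  have := sound_submodular snd XA YA; rewrite -setUIl -setUUl /f1 /f; lra.
have sub2 : submodular_on V' f2.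
  move=> X Y XV' YV'; have [-> |/eqP XN] := eqVneq X V'.
    by rewrite (setIidPr YV') (setUidPl YV') addrC.
  have [-> |/eqP YN] := eqVneq Y V'.
    by rewrite (setIidPl XV') (setUidPr XV').
  rewrite {3 4}/f2 (introF eqP XN) (introF eqP YN).
  have := sub1 X Y XV' YV'; have := f2_le (X :&: Y); have := f2_le (X :|: Y).
  lra.
split; rewrite ?f2E //=.
- by apply: trivIsetS (sound_triv snd).
- by apply: contra (sound_set0 snd); apply: (subsetP V'V).
- exact: leq_trans (subset_leq_card V'V) (sound_card snd).
- by rewrite f2_set0 f1_set0.
- by rewrite /f2 eqxx ge_min lexx.
- exact: subsetIr.
- move=> u; have := sound_irreflexive snd u.
  by rewrite /arc /= inE => ->.
- move=> X minX u w; rewrite in_setI in_setX => /and3P[uw _ wV'] uX.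
  have [-> //|/eqP XN] := eqVneq X V'.
  have eqX : f2 X = f1 X by rewrite /f2 (introF eqP XN).
  have := sound_closed snd (lift_minimizer minX eqX) uw.
  move: wV'; rewrite in_setD => /andP[wA _].
  by rewrite !in_setU uX (negPf wA) orbF => /(_ isT).
- move=> X minX fX.
  have minXA := lift_minimizer minX (f2_neg fX).
  have := sound_negative snd minXA (neg_lift minXA).
  by rewrite -setUA [A :|: _]setUC.
- move=> min0; have := lift_minimizer min0 f2_set0; rewrite set0U => minA.
  by have := sound_negative snd minA (neg_lift minA); rewrite setUC.
- move=> X.
  have V1 : (#|V'| < #|V|)%N.
    apply: proper_card; apply/properP; split=> //; exists v => //.
    by rewrite !inE connect0.
  have V1R : #|V'|%:R + 1 <= #|V|%:R :> R by rewrite natr1 ler_nat.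
  have Vn : #|V|%:R <= #|V0|%:R :> R by rewrite ler_nat (sound_card snd).
  have := sound_cost snd (X :|: A); have := EO_ge0.
  rewrite -/V -/A -/V'; case: ifP => _ /=; lra.
Qed.

(** Were the capped minimum 0, the empty set would be a minimizer after the
    contraction and [A] one before it, in contradiction to [w \notin A]. *)
Lemma contract_down_forced w : w \in nodes s' -> forced s w -> forced s' w.
Proof.
rewrite /= in_setD => /andP[wA _] w_forced X minX.
have wXA Y : minimizer V' f2 Y -> f2 Y = f1 Y -> w \in Y.
  move=> minY eqY; have := w_forced _ (lift_minimizer minY eqY).
  by rewrite in_setU (negPf wA) orbF.
rewrite /= f2E in minX.
have := minX.2 _ (sub0set _); rewrite f2_set0 f1_set0 le_eqVlt.
case/predU1P => [X0|/f2_neg/(wXA _ minX) //].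
suff /wXA/(_ f2_set0) : minimizer V' f2 set0 by rewrite inE.
split=> [|Y YV']; first exact: sub0set.
by rewrite f2_set0 f1_set0 -X0 minX.2.
Qed.

Lemma contract_down_cost : (contract_downM s v).2 <= 2 * eval_bound + 2.
Proof.
rewrite /contract_downM /=.
have := sound_cost_le A snd; have := sound_cost_le (V' :|: A) snd.
rewrite -/A -/V'; lra.
Qed.

End ContractDown.

Local Opaque contract_downM.

(** Being forced is established once, for the function at the start; it survives
    the contractions of the other elements. *)
Lemma contract_forcedM_val_cost s y thr : sound s ->
  {in nodes s, forall v, y v < thr -> forced s v} ->
  let r := contract_forcedM enumS s y thr in
  [/\ sound r.1,
      nodes r.1 \subset nodes s /\
      arcs r.1 = arcs s :&: setX (nodes r.1) (nodes r.1),
      {in nodes s, forall v, y v < thr -> v \notin nodes r.1} &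
      r.2 <= #|nodes s|%:R * (2 * eval_bound + 3)].
Proof.
move=> snd all_forced.
rewrite /contract_forcedM; set k := (fun s' v => _).
have kE s1 v : k s1 v = if v \notin nodes s1 then ret R s1 else
    (let* c := ltM (y v) thr in if c then contract_downM s1 v else ret R s1).
  by [].
clearbody k; have E0 : 0 <= eval_bound by rewrite addr_ge0.
have main (L : seq N) s1 : sound s1 -> nodes s1 \subset nodes s ->
    arcs s1 = arcs s :&: setX (nodes s1) (nodes s1) ->
    {in nodes s1, forall v, y v < thr -> forced s1 v} ->
  let r := foldM k s1 L in
  [/\ sound r.1,
      nodes r.1 \subset nodes s1 /\
      arcs r.1 = arcs s :&: setX (nodes r.1) (nodes r.1),
      forall v, v \in L -> y v < thr -> v \notin nodes r.1 &
      r.2 <= (size L)%:R * (2 * eval_bound + 3)].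
  elim: L s1 => [|v L IH] s1 snd1 sub1 arcs1 forced1.
    by rewrite foldM_nil /= mul0r.
  rewrite foldM_cons /= -natr1 mulrDl mul1r kE.
  have [v_in|v_out] := boolP (v \in nodes s1); last first.
    have [H1 [H2 H3] H4 H5] := IH s1 snd1 sub1 arcs1 forced1.
    rewrite /=; split=> //; last by lra.
    move=> w; rewrite inE => /predU1P[->|]; last exact: H4.
    by move=> _; apply: contra v_out; apply: (subsetP H2).
  rewrite /=; case: ifP => yv /=; last first.
    have [H1 [H2 H3] H4 H5] := IH s1 snd1 sub1 arcs1 forced1.
    split=> //; last by lra.
    by move=> w; rewrite inE => /predU1P[->|]; [rewrite yv|apply: H4].
  have vf := forced1 v v_in yv.
  have snd2 := contract_down_sound snd1 v_in vf.
  have cost2 := contract_down_cost v snd1.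
  have sub2 : nodes (contract_downM s1 v).1 \subset nodes s1.
    by rewrite contract_down_nodes subsetDl.
  have [|||H1 [H2 H3] H4 H5] := IH (contract_downM s1 v).1 snd2.
  - exact: subset_trans sub2 sub1.
  - rewrite contract_down_arcs arcs1 -setIA; congr (_ :&: _).
    rewrite contract_down_nodes.
    apply/setP => -[a b]; rewrite !inE /=.
    by case: (a \in nodes s1); case: (b \in nodes s1); rewrite ?andbF ?andbT.
  - move=> w w2 yw; apply: contract_down_forced => //.
    by apply: forced1 => //; apply: (subsetP sub2).
  split=> //; first by split=> //; apply: subset_trans H2 sub2.
    move=> w; rewrite inE => /predU1P[->|]; last exact: H4.
    move=> _; apply/negP => /(subsetP H2).
    by rewrite contract_down_nodes !inE connect0.
  lra.
have [|H1 H2 H3 H4] := main (enumS (nodes s)) s snd (subxx _) _ all_forced.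
  by apply/esym/setIidPl/(sound_arcs snd).
rewrite (ordering_size (enumP _)) in H4; split=> //.
by move=> v vV; apply: H3; rewrite (ordering_mem (enumP _)).
Qed.

End Contractions.

(** * Contraction of the strongly connected components *)

Section Components.
Variables (R : realType) (V0 : finType).
Local Notation N := {set V0}.
Variables (fO : {set V0} -> R) (EO : R) (s : state R V0).
Hypothesis snd : sound fO EO s.
Implicit Types (X Y : {set N}) (a b u v w : N).

Let V := nodes s.
Let F := arcs s.
Let s' := contract_scc s.
Local Notation node := (scc_node F).
Local Notation class u := [set w | connect (arc F) u w && connect (arc F) w u].
Local Notation preimage X := [set u in V | node u \in X].

Let class_sub u : u \in V -> class u \subset V.
Proof.
move=> uV; apply/subsetP => w; rewrite inE => /andP[uw _].
exact: (down_closed_connect (ground_closed (sound_arcs snd)) uw uV).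
Qed.

Let meet_eq u w x : u \in V -> w \in V -> x \in u -> x \in w -> u = w.
Proof.
move=> uV wV xu xw; apply/eqP/negPn/negP => uw.
have /trivIsetP/(_ _ _ uV wV uw) := sound_triv snd.
by rewrite disjoint_sym => /disjoint_setI0/setP/(_ x); rewrite !inE xu xw.
Qed.

Let node_connect u v : connect (arc F) u v -> connect (arc F) v u ->
  node u = node v.
Proof.
move=> uv vu; congr cover; apply/setP => w; rewrite !inE.
by apply/andP/andP => -[h1 h2]; split; do ?[exact: connect_trans h1
  | exact: connect_trans h2 _ | exact: connect_trans uv h1
  | exact: connect_trans vu h1 | exact: connect_trans h2 uv
  | exact: connect_trans h2 vu].
Qed.

Let nonempty u : u \in V -> exists x, x \in u.
Proof.
by move=> uV; apply/set0Pn; apply: contraTneq uV => ->; apply: sound_set0 snd.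
Qed.

(** The nodes are pairwise disjoint, so a union of nodes determines them. *)
Let node_inj u v : u \in V -> v \in V -> node u = node v ->
  connect (arc F) u v /\ connect (arc F) v u.
Proof.
move=> uV vV eq_uv; have [x xu] := nonempty uV.
have : x \in node u by apply/bigcupP; exists u; rewrite ?inE ?connect0.
rewrite eq_uv => /bigcupP[w wv xw].
have wV := subsetP (class_sub vV) w wv.
by move: wv; rewrite (meet_eq uV wV xu xw) inE => /andP[].
Qed.

Let cover_preimage X : X \subset nodes s' -> cover (preimage X) = cover X.
Proof.
move=> XV'; apply/setP => x; apply/bigcupP/bigcupP => -[u].
  rewrite inE => /andP[uV uX] xu; exists (node u) => //.
  by apply/bigcupP; exists u; rewrite ?inE ?connect0.
move=> uX; have /imsetP[v vV uE] := subsetP XV' u uX.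
rewrite uE => /bigcupP[w wv xw]; exists w => //.
rewrite inE (subsetP (class_sub vV) w wv) /=.
move: wv; rewrite inE => /andP[vw wv].
by rewrite (node_connect wv vw) -uE.
Qed.

Let preimage_image X : X \subset V -> down_closed F X ->
  preimage [set node u | u in X] = X.
Proof.
move=> XV clX; apply/setP => u; rewrite inE; apply/andP/idP => [[uV]|uX].
  case/imsetP => v vX /node_inj[||_ vu] //; first exact: (subsetP XV).
  exact: (down_closed_connect clX vu).
by split; [apply: (subsetP XV) | apply: imset_f].
Qed.

(** A minimizer on the old nodes is closed, hence a union of components, so the
    minimum over the new nodes is not larger. *)
Let minimizer_preimage X : minimizer (nodes s') (fval s') X ->
  minimizer V (fval s) (preimage X).
Proof.
move=> [XV' minX]; split=> [|Y YV].
  by apply/subsetP => u; rewrite inE => /andP[].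
have [M [MV minM]] := exists_minimizer V (fval s).
apply: le_trans (minM Y YV).
have clM : down_closed F M by apply: (sound_closed snd).
rewrite -[X in _ <= fval s X](preimage_image MV clM).
by apply: (minX [set node u | u in M]); apply: imsetS.
Qed.

Let arcs_sub u v : (u, v) \in F -> u \in V /\ v \in V.
Proof.
by move=> /(subsetP (sound_arcs snd)); rewrite inE => /andP[].
Qed.

Let quotient_closed X : down_closed F (preimage X) ->
  down_closed (quotient_arcs F) X.
Proof.
move=> clX a b /imsetP[[u v]]; rewrite inE => /andP[uv _] [-> ->] /= uX.
have [uV vV] := arcs_sub uv.
by have := clX u v uv; rewrite !inE uV vV uX => /(_ isT).
Qed.

Let quotient_connect u b :
  u \in V -> connect (arc (quotient_arcs F)) (node u) b ->
  exists2 v, v \in V & b = node v /\ connect (arc F) u v.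
Proof.
move=> uV /connectP[p + ->]; elim: p u uV => [|c p IH] u uV /=.
  by exists u => //; rewrite connect0.
case/andP => /imsetP[[u' v']]; rewrite inE => /andP[uv' _] [uE cE] pp.
have [u'V v'V] := arcs_sub uv'; rewrite /= in uE cE; subst c.
have [v vV [-> v'v]] := IH v' v'V pp.
have [uu' _] := node_inj uV u'V uE; exists v => //; split=> //.
by apply: connect_trans (connect_trans uu' _) v'v; apply: connect1.
Qed.

Let closure_source a b : a != b -> connect (arc (quotient_arcs F)) a b ->
  a \in nodes s'.
Proof.
move=> ab /connectP[[|c p] /=]; first by move=> _ ba; rewrite ba eqxx in ab.
case/andP => /imsetP[[u v]]; rewrite inE => /andP[uv _] [-> _] _ _.
by apply: imset_f; case: (arcs_sub uv).
Qed.

Lemma contract_scc_sound : sound fO EO s'.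
Proof.
have card_le : (#|nodes s'| <= #|V|)%N by apply: leq_imset_card.
have preI X Y : preimage (X :&: Y) = preimage X :&: preimage Y.
  by apply/setP => u; rewrite !inE andbACA andbb.
have preU X Y : preimage (X :|: Y) = preimage X :|: preimage Y.
  by apply/setP => u; rewrite !inE andb_orr.
have pre0 : preimage set0 = set0 by apply/setP => u; rewrite !inE andbF.
have preV X : preimage X \subset V.
  by apply/subsetP => u; rewrite inE => /andP[].
have preV' : preimage (nodes s') = V.
  by apply/setP => u; rewrite inE andb_idr //; apply: imset_f.
have V'closed : down_closed (quotient_arcs F) (nodes s').
  apply: quotient_closed; rewrite preV'.
  exact/ground_closed/(sound_arcs snd).
split.
- apply/trivIsetP => _ _ /imsetP[u uV ->] /imsetP[v vV ->].
  apply: contraNT => /pred0Pn[x /andP[/= /bigcupP[w wu xw]]].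
  case/bigcupP => w' wv xw'.
  have wV := subsetP (class_sub uV) w wu.
  have wV' := subsetP (class_sub vV) w' wv.
  rewrite -(meet_eq wV wV' xw xw') in wv.
  move: wu wv; rewrite !inE => /andP[uw wu] /andP[vw wv].
  by rewrite (node_connect uw wu) (node_connect vw wv).
- apply/imsetP => -[u uV /setP u0]; have [x xu] := nonempty uV.
  have := u0 x; rewrite inE => /esym/negbT/bigcupP[].
  by exists u; rewrite ?inE ?connect0.
- exact: leq_trans card_le (sound_card snd).
- move=> X Y _ _; rewrite /fval /= -/F -/V preI preU.
  exact: (sound_submodular snd).
- by rewrite /fval /= -/F -/V pre0; apply: sound_fval0 snd.
- by rewrite /fval /= -/F -/V -/(nodes s') preV'; apply: sound_fvalV snd.
- apply/subsetP => -[a b]; rewrite !inE /= => /andP[ab cab].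
  have aV' := closure_source ab cab; rewrite -/(nodes s') aV' /=.
  exact: down_closed_connect V'closed cab aV'.
- by move=> a; rewrite /arc /= inE eqxx.
- move=> X /minimizer_preimage/(sound_closed snd)/quotient_closed clX a b.
  by rewrite inE /= => /andP[_ cab]; apply: down_closed_connect clX cab.
- move=> X minX fX Y; have minpX := minimizer_preimage minX.
  have /(_ Y) := sound_negative snd minpX fX.
  by rewrite /cover !bigcup_setU -!/(cover _) cover_preimage //; case: minX.
- move=> /minimizer_preimage; rewrite pre0; exact: (sound_empty snd).
- move=> X; rewrite /=; apply: le_trans (sound_cost snd _) _.
  by rewrite lerD2l lerD2l lerN2 ler_nat.
Qed.

(** Transitivity of a closure without loops is acyclicity: a cycle of components
    would be contained in a single component. *)
Lemma contract_scc_transitive : transitive (arc (arcs s')).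
Proof.
move=> b a c; rewrite /arc /= !inE /= => /andP[ab cab] /andP[bc cbc].
rewrite (connect_trans cab cbc) andbT; apply: contra ab => /eqP ac.
rewrite -ac in cbc; have /imsetP[u uV aE] : a \in nodes s'.
  by apply: closure_source cab; apply: contraNneq bc => <-; rewrite ac.
have [|v vV [bE uv]] := quotient_connect uV (b := b); first by rewrite -aE.
have [|u' u'V [u'E vu']] := quotient_connect vV (b := a); first by rewrite -bE.
have [_ u'u] := node_inj uV u'V (etrans (esym aE) u'E).
by rewrite aE bE (node_connect uv (connect_trans vu' u'u)).
Qed.

Lemma contract_scc_card : (#|nodes s'| <= #|V|)%N.
Proof. exact: leq_imset_card. Qed.

(** Pairs of components that are not joined by an arc are images of pairs of
    nodes that are not. *)
Lemma contract_scc_nonarcs :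
  (#|setX (nodes s') (nodes s') :\: arcs s'| <= #|setX V V :\: F|)%N.
Proof.
pose g (a : N * N) := (node a.1, node a.2).
apply: leq_trans (leq_imset_card g (setX V V :\: F)).
apply/subset_leq_card/subsetP => -[a b]; rewrite in_setD in_setX /=.
case/and3P => nab /imsetP[u uV aE] /imsetP[v vV bE].
have [ab|ab] := eqVneq a b.
  apply/imsetP; exists (u, u); last by rewrite -ab aE.
  rewrite in_setD in_setX uV !andbT.
  by have := sound_irreflexive snd u; rewrite /arc /= => ->.
apply/imsetP; exists (u, v); last by rewrite aE bE.
rewrite in_setD in_setX uV vV !andbT; apply: contra nab => uv.
rewrite inE /= ab /=; apply/connect1/imsetP.
exists (u, v); last by rewrite aE bE.
by rewrite inE uv /= -aE -bE.
Qed.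

End Components.

(** * One main iteration *)

Section Iteration.
Variables (R : realType) (V0 : finType).
Local Notation N := {set V0}.
Variables (fO : {set V0} -> R) (EO : R) (kappa : nat) (O : sfm_oracle R N).
Variables (enumS : {set N} -> seq N) (ck : nat).
Hypothesis EO_ge0 : 0 <= EO.
Hypothesis kappa_le : (kappa <= ck * #|V0|)%N.
Hypothesis oracleP : approx_sfm #|V0| kappa O.
Hypothesis enumP : forall S, ordering S (enumS S).
Implicit Types (s : state R V0) (X Y A U : {set N}) (u v w : N).

Local Notation n := (#|V0|%:R : R).
Local Notation sound := (sound fO EO).
Local Notation optimal := (optimal fO).

Definition loop_invariant s := sound s /\ transitive (arc (arcs s)).

Definition nonarcs s := #|setX (nodes s) (nodes s) :\: arcs s|.

Definition base_const : R := 4 * kappa%:R * n.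

Definition oracle_delta p : R := 1 / (base_const ^+ 4) ^+ p.+2.

Definition overhead : R := (8 * ck%:R + 130) * (n * EO + n ^+ 2).

Lemma invariant_acyclic s : loop_invariant s ->
  transitive_acyclic (nodes s) (arcs s).
Proof.
case=> snd trF; split=> //; first exact: sound_arcs snd.
exact: sound_irreflexive snd.
Qed.

Lemma add_justified_sound s (F' : {set N * N}) : sound s -> arcs s \subset F' ->
  (forall a, a \in F' -> a \in arcs s \/
     justified (nodes s) (evalf s) (arcs s) a) ->
  sound (State (nodes s) (evalf s) F' (taken s)).
Proof.
move=> snd FF' F'P; case: (snd) => ? ? ? ? ? ? arcsV irr clos ? ? ?; split=> //.
- apply/subsetP => -[a b] /F'P[/(subsetP arcsV) //|[/= bV]].
  by rewrite !inE bV => /andP[_ ->].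
- move=> a; apply/negP => /F'P[|[/= _]].
    by move: (irr a); rewrite /arc /= => ->.
  by rewrite !inE connect0.
- move=> X minX a b /F'P[|[_ _ /(_ X minX (clos X minX))]] //.
  exact: (clos X minX).
Qed.

Lemma nonarcs_restrict (V V2 : {set N}) (F F' : {set N * N}) :
  V2 \subset V -> F \subset F' ->
  (#|setX V2 V2 :\: (F' :&: setX V2 V2)| <= #|setX V V :\: F|)%N.
Proof.
move=> sV sF; apply/subset_leq_card/subsetP => a.
rewrite !inE => /andP[na /andP[a1 a2]].
rewrite (subsetP sV) // (subsetP sV) // andbT; move: na; rewrite a1 a2 !andbT.
by apply: contra; apply: (subsetP sF).
Qed.

(** New arcs with distinct heads are distinct. *)
Lemma nonarcs_new_heads (V Z : {set N}) (F F' : {set N * N}) :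
  F \subset F' ->
  {in Z, forall z, exists v, [/\ (v, z) \in F', (v, z) \notin F,
                                 v \in V & z \in V]} ->
  (#|setX V V :\: (F' :&: setX V V)| + #|Z| <= #|setX V V :\: F|)%N.
Proof.
move=> FF' newZ.
have ZD : (#|Z| <= #|(F' :\: F) :&: setX V V|)%N.
  apply: leq_trans (leq_imset_card snd ((F' :\: F) :&: setX V V)).
  apply/subset_leq_card/subsetP => z /newZ[v [vz vzF vV zV]].
  by apply/imsetP; exists (v, z); rewrite // !inE vz vzF vV zV.
apply: leq_trans (leq_add (leqnn _) ZD) _.
rewrite -cardsUI [X in (_ + #|pred_of_set X|)%N](_ : _ = set0); last first.
  apply/setP => a; rewrite !inE.
  case: (a \in F'); rewrite ?andbF //=.
  by case: (a.1 \in V); case: (a.2 \in V); rewrite ?andbF.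
rewrite cards0 addn0; apply/subset_leq_card/subsetP => a; rewrite !inE.
move/subsetP/(_ a): FF'.
case: (a \in F) => /=; case: (a \in F') => //=;
  by case: (a.1 \in V); case: (a.2 \in V) => // /(_ isT).
Qed.

(** The last inequality is where the fourth power of [4 kappa n] comes from:
    it must exceed the factor of ell_ge_of_failed_test times [2 n ^ 2 + 1]. *)
Lemma base_const_big (k m : nat) : (0 < k)%N -> (k <= kappa)%N ->
  (0 < m)%N -> (m <= #|V0|)%N ->
  [/\ 4 <= base_const, 2 * m%:R < base_const ^+ 4 &
      (2 * (n * n) + 1) * ((2 * k%:R * m%:R + 1) * m%:R + 1)
        < base_const ^+ 4].
Proof.
rewrite -[(k <= _)%N](ler_nat R) -[(m <= _)%N](ler_nat R) /base_const.
move=> k0 kk m0 mn.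
have {}k0 : 1 <= k%:R :> R by rewrite ler1n.
have {}m0 : 1 <= m%:R :> R by rewrite ler1n.
move: k0 m0 kk mn; set K := kappa%:R; set k' := k%:R; set m' := m%:R.
move=> k0 m0 kk mn.
have K1 : 1 <= K by exact: le_trans kk.
have n1 : 1 <= n by exact: le_trans mn.
have Kn1 : 1 <= K * n by rewrite mulr_ege1.
have nKn : n <= K * n by rewrite ler_peMl //; lra.
have n21 : 1 <= n * n by rewrite mulr_ege1.
have nn : n <= n * n by rewrite ler_peMl //; lra.
have Knn1 : 1 <= K * (n * n) by rewrite mulr_ege1.
have e0 : (4 * K * n) ^+ 4 = 256 * (K * n) ^+ 4 by ring.
have e1 : (K * n) ^+ 4 = (K * n) * (K * n) ^+ 3 by rewrite -exprS.
have Kn3 : 1 <= (K * n) ^+ 3 by rewrite exprn_ege1.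
have big1 : K * n <= (K * n) ^+ 4 by rewrite e1 ler_peMr //; lra.
split; first by lra.
  by rewrite e0; lra.
have a1 : k' * m' <= K * n by apply: ler_pM => //; lra.
have a2 : (2 * k' * m' + 1) * m' <= (2 * (K * n) + 1) * n.
  by apply: ler_pM => //; try lra; rewrite -mulrA; nra.
have a3 : (2 * (K * n) + 1) * n + 1 <= 4 * (K * (n * n)).
  have -> : (2 * (K * n) + 1) * n = 2 * (K * (n * n)) + n by ring.
  have : n * n <= K * (n * n) by rewrite ler_peMl //; lra.
  lra.
have a4 : (2 * (n * n) + 1) * ((2 * k' * m' + 1) * m' + 1)
    <= (3 * (n * n)) * (4 * (K * (n * n))).
  have p : 0 <= (2 * k' * m' + 1) * m'.
    by rewrite !mulr_ge0 ?addr_ge0 ?mulr_ge0 //; lra.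
  by apply: ler_pM => //; lra.
apply: le_lt_trans a4 _; rewrite e0.
have e2 : (K * n) ^+ 4 = (K * (n * n)) * (K * (n * n)) * (K * K) by ring.
have KK : 1 <= K * K by rewrite mulr_ege1.
have b1 : (n * n) * (K * (n * n)) <= (K * (n * n)) * (K * (n * n)).
  by apply: ler_wpM2r; [lra | rewrite ler_peMl //; lra].
have b2 : (K * (n * n)) * (K * (n * n)) <= (K * n) ^+ 4.
  by rewrite e2 ler_peMr //; rewrite mulr_ge0 //; lra.
have : 0 < (K * n) ^+ 4 by lra.
have : 3 * (n * n) * (4 * (K * (n * n))) = 12 * ((n * n) * (K * (n * n))).
  by ring.
lra.
Qed.

Lemma kappa_gt0 : (0 < #|V0|)%N -> (0 < kappa)%N.
Proof.
move=> V0_gt0; have [||||//|_ [ksz ksum _ _] _ _] :=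
  oracleP (U := [set set0]) (h := fun=> 0) (delta := 1).
- by rewrite -card_gt0 cards1.
- by rewrite cards1.
- by move=> X Y _ _.
- by [].
apply: leq_trans ksz; case: (out_terms _) ksum => //.
by rewrite big_nil => /esym/eqP; rewrite oner_eq0.
Qed.

(** The summands on the left are the costs of the steps of an iteration outside
    the oracle, with [m] nodes, [r] of them outside the level set, evaluation
    cost [E], [k] terms and [z] pushes. *)
Lemma overhead_bound (m E k r z : R) : 1 <= n -> 0 <= m <= n ->
  E = EO + n -> 0 <= k <= ck%:R * n -> 0 <= r <= m -> 0 <= z ->
  m * (2 * E + 1) + m * 2 + m * 1 + (m + 1) * (m + 4)
  + (E + m * 2 + 1 + r * (E + m * 2 + 1 + 1))
  + (m * (E + m * 2 + 4)
     + z * (k * (m + 3) + (E + m * 2 + 1 + m * (E + m * 2 + 1 + 1))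
            + m * 6 + 1))
  + m * (2 * E + 3) + 20 <= overhead * (1 + z).
Proof.
move=> n1 /andP[m0 mn] EE /andP[k0 kn] /andP[r0 rm] z0.
pose B := n * E + n ^+ 2.
have EO0 := EO_ge0.
have E1 : 1 <= E by lra.
have E0 : 0 <= E by lra.
have nn : n <= n ^+ 2 by rewrite expr2 ler_peMl //; lra.
have mE : m * E <= n * E by apply: ler_wpM2r.
have EnE : E <= n * E by rewrite ler_peMl.
have mm : m * m <= n ^+ 2 by rewrite expr2; apply: ler_pM.
have rE : r * E <= m * E by apply: ler_wpM2r.
have rmm : r * m <= m * m by apply: ler_wpM2r.
have c0 : 0 <= ck%:R :> R by rewrite ler0n.
have km : k * m <= ck%:R * n ^+ 2.
  by rewrite expr2 mulrA; apply: ler_pM.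
have cn : ck%:R * n <= ck%:R * n ^+ 2 by apply: ler_wpM2l.
have nE0 : 0 <= n * E by rewrite mulr_ge0 //; lra.
have cE0 : 0 <= ck%:R * (n * E) by rewrite mulr_ge0.
have BE : B <= 2 * (n * EO + n ^+ 2).
  have : n * E = n * EO + n ^+ 2 by rewrite EE; ring.
  have : 0 <= n * EO by rewrite mulr_ge0.
  rewrite /B; lra.
have push : k * (m + 3) + (E + m * 2 + 1 + m * (E + m * 2 + 1 + 1)) + m * 6 + 1
    <= (4 * ck%:R + 65) * B by rewrite /B; lra.
have rest : m * (2 * E + 1) + m * 2 + m * 1 + (m + 1) * (m + 4)
  + (E + m * 2 + 1 + r * (E + m * 2 + 1 + 1))
  + m * (E + m * 2 + 4) + m * (2 * E + 3) + 20 <= (4 * ck%:R + 65) * B.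
  by rewrite /B; lra.
have big : (4 * ck%:R + 65) * B <= overhead.
  rewrite /overhead; have : 0 <= 4 * ck%:R + 65 :> R by lra.
  move=> /ler_wpM2l/(_ _ _ BE); lra.
have zbig : z * (4 * ck%:R + 65) * B <= z * overhead.
  by rewrite -mulrA; apply: ler_wpM2l.
have zpush := ler_wpM2l z0 push.
lra.
Qed.

(** Many elements may owe their failed tests to one contracted node, so a
    contraction is not measured by the level set [U] but by the number of nodes
    alone. *)
Definition progress s s' (U : {set N}) (succ : nat) : Prop :=
  (#|nodes s'| < #|nodes s|)%N /\ (nonarcs s' <= nonarcs s)%N \/
  [/\ (#|nodes s'| <= #|nodes s|)%N, (#|U| <= 2 * succ)%N &
      (nonarcs s' + succ <= nonarcs s)%N].

Local Opaque foldM vsumM vnegM tabulateM filterM ellM fdownM greedyM best_termM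
  levelM add_arcsM contract_forcedM contract_scc.

Local Notation iteration := (iterationM kappa O enumS).

Lemma iterationM_stop s : loop_invariant s -> (iteration s).1 = None ->
  optimal (taken s) /\
  (iteration s).2 <= #|nodes s|%:R * (2 * (EO + n) + 3) + 1.
Proof.
move=> inv; have [snd _] := inv; have taF := invariant_acyclic inv.
have evE X := sound_cost_le X snd.
have ellc := ellM_cost enumP evE (nodes s) (arcs s).
rewrite /iterationM /= vnegM_val //.
set l := ellM _ _ _ _ in ellc *.
have lc := vnegM_cost enumP l.1 (nodes s).
rewrite -(eq_vneg (z := ell (nodes s) (fval s) (arcs s))) //; last first.
  by move=> v vV; rewrite /l ellM_val.
case: ltP => //= lV _; split; last by lra.
apply: (sound_empty snd); split=> [|Y YV]; first exact: sub0set.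
have [M [MV minM]] := exists_minimizer (nodes s) (fval s).
rewrite (sound_fval0 snd); apply: le_trans (minM Y YV).
apply: (ell_nonneg_min0 taF (sound_submodular snd) (sound_fval0 snd) lV MV).
exact: (sound_closed snd).
Qed.

Lemma iterationM_next s s' : loop_invariant s -> (iteration s).1 = Some s' ->
  loop_invariant s' /\
  exists U p succ,
  [/\ [/\ U \subset nodes s, U != set0 & (2 ^ p <= #|nodes s|)%N],
      (succ <= #|nodes s|)%N, progress s s' U succ &
      (iteration s).2 <=
        orc_time O U (fdown (nodes s) (fval s) (arcs s)) (oracle_delta p)
        + overhead * (1 + succ%:R)].
Proof.
move=> inv; have [snd _] := inv; have taF := invariant_acyclic inv.
have evE X := sound_cost_le X snd.
set V := nodes s; set F := arcs s in taF *; set f := fval s.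
have [sF irF _] := taF; rewrite -/V in taF sF.
have subf : submodular_on V f := sound_submodular snd.
have f0 : f set0 = 0 := sound_fval0 snd.
have fV : f V <= 0 := sound_fvalV snd.
have subh := fdown_submodular taF subf.
have h0 : fdown V f F set0 = 0 by rewrite fdown0.
have ellc := ellM_cost enumP evE V F.
rewrite /iterationM /= -/V -/F vnegM_val //.
have lE : {in V, (ellM enumS V (evalf s) F).1 =1 ell V f F}.
  exact: ellM_val.
set l := ellM enumS V (evalf s) F in ellc lE *.
have lc := vnegM_cost enumP l.1 V.
set lV := vneg l.1 V; have lVE : lV = vneg (ell V f F) V by apply: eq_vneg.
case: ltP => //= lVneg; rewrite !filterM_val //=.
have Vgt0 : (0 < #|V|)%N.
  rewrite lt0n; apply: contraTN lVneg => /eqP/cards0_eq VE.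
  by rewrite /lV VE [vneg _ _]vsum0 ltxx.
have Vn : (#|V| <= #|V0|)%N := sound_card snd.
have VnR : #|V|%:R <= n by rewrite ler_nat.
have output U d : U != set0 -> U \subset V -> 0 < d ->
    approx_sfm_output kappa U (fdown V f F) d (orc_out O U (fdown V f F) d).
  move=> U0 UV d0; apply: oracleP => //.
    exact: leq_trans (subset_leq_card UV) Vn.
  move=> X Y XU YU; apply: subh; exact: subset_trans UV.
have kappa0 := kappa_gt0 (leq_trans Vgt0 Vn).
have QE : 4 * kappa%:R * n * (4 * kappa%:R * n)
    * (4 * kappa%:R * n * (4 * kappa%:R * n)) = base_const ^+ 4.
  by rewrite /base_const; ring.
rewrite QE; set Q := base_const ^+ 4.
have [base4 Qbig _] := base_const_big kappa0 (leqnn _) Vgt0 Vn.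
have Q1 : 1 <= Q by apply: exprn_ege1; lra.
have level0E : [set v in V | l.1 v <= 2 * lV] = level V l.1 (2 * lV) Q 0.
  by apply/setP => v; rewrite !inE expr0 divr1.
rewrite level0E.
have [b [levE half b_ne [p bE pV]]] := level_search enumP (erefl _) lVneg Qbig.
have levc := levelM_cost enumP V l.1 (2 * lV) Q #|V|
  (level V l.1 (2 * lV) Q 0) 1.
have filc := @filterM_cost R _ _ enumP (fun v => leM (l.1 v) (2 * lV)) V 1
  (fun=> lexx _).
rewrite -/Q -/lV in levE.
set lev := levelM _ _ _ _ _ _ _ _ in levE levc *.
rewrite levE /=; subst b.
rewrite -[1 / Q ^+ p.+2]/(oracle_delta p).
set U := level V l.1 (2 * lV) Q p.+2 in levE half *.
set d := oracle_delta p.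
have Q0 : 0 < Q by apply: lt_le_trans Q1.
have d0 : 0 < d by rewrite /d /oracle_delta divr_gt0 // exprn_gt0.
have UV : U \subset V by apply/subsetP => v; rewrite inE => /andP[].
have thrE : 2 * lV / Q ^+ p.+2 = 2 * lV * d.
  by rewrite /d /oracle_delta div1r.
have thrE' : 2 * lV / Q ^+ p.+1 = 2 * lV * d * Q.
  rewrite /d /oracle_delta -/Q [Q ^+ p.+2]exprS; field.
  by rewrite expf_neq0 ?gt_eqF.
have lVd : 2 * lV * d < 0 by rewrite pmulr_llt0 //; lra.
have levelU : level V l.1 (2 * lV) Q p.+1 \subset U.
  apply/subsetP => v; rewrite !inE thrE thrE' => /andP[-> /= lv].
  apply: le_trans lv _; rewrite ger_nMr //.
have U_ne : U != set0.
  by apply: contraNneq b_ne => U0; rewrite -subset0 -U0.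
have [oU [osz osum oterms ovec] obase oW] := output U d U_ne UV d0.
rewrite -[fdown V (fval s) F]/(fdown V f F).
set o := orc_out O U (fdown V f F) d in oU osz osum oterms ovec obase oW *.
have decU : decomposition U (fdown V f F) (out_vec o) (out_terms o) by [].
set vs := enumS (V :\: U).
have ovs : ordering (V :\: U) vs by apply: enumP.
set e := greedyM _ _ _.
have fdcost X := fdownM_cost enumP evE l.1 X sF.
have ec := greedyM_cost fdcost U vs.
rewrite -/e in ec.
have eE : {in V :\: U, forall v,
    let A := U :|: [set u in take (index v vs) vs] in
    e.1 v = fdown V f F (v |: A) - fdown V f F A}.
  move=> v vVU A; rewrite /e greedyM_val ?(ordering_mem ovs) //; last first.
    exact: ordering_uniq ovs.
  have vV : v \in V by move: vVU; rewrite inE => /andP[].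
  have AV : A \subset V.
    rewrite subUset UV; apply/subsetP => u; rewrite inE => /mem_take.
    by rewrite (ordering_mem ovs) inE => /andP[].
  have vAV : v |: A \subset V by rewrite subUset sub1set vV.
  by rewrite -/A !(fdownM_val enumP sF).
pose extend (z : N -> R) := fun v => if v \in U then z v else e.1 v.
pose y := extend (out_vec o).
pose ts := [seq WTerm (coef t) (order_of t ++ vs) (extend (base_of t))
             | t <- out_terms o].
have dec : decomposition V (fdown V f F) y ts :=
  extend_decomposition UV ovs eE decU.
rewrite -[fun v => if v \in U then out_vec o v else e.1 v]/y.
rewrite -[map _ (out_terms o)]/ts.
have tsz : size ts = size (out_terms o) by rewrite size_map.
have [FF' F'P newF' addc] := add_arcsM_val_cost enumP taF subf f0 lE dec evE.
set F' := add_arcsM _ _ _ _ _ _ _ in FF' F'P newF' addc *.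
have yB := decomposition_in_base subh h0 dec.
have snd' := add_justified_sound snd FF' F'P.
set s1 := State V (evalf s) F'.1 (taken s) in snd' *.
(* thr = (2 n ^ 2 + 1) (2 lV d), and 2 lV d < 0 is the unit of all errors. *)
set thr := 2 * lV * _.
have thr_def : thr = (2 * (n * n) + 1) * (2 * lV * d) by rewrite /thr /d; ring.
have n1 : 1 <= n by rewrite ler1n; apply: leq_trans Vn.
have nn : n <= n * n by rewrite ler_peMl //; lra.
have forced1 : {in nodes s1, forall v, y v < thr -> forced s1 v}.
  move=> v vV yv X minX.
  have clX : down_closed F X := sound_closed snd minX.
  have oW' : fdown V f F (out_set o) <=
      vneg y V + (#|V|%:R * - (2 * lV * d) - 2 * d * vneg (ell V f F) V).
    apply: (extended_certificate (U := U) taF subf fV UV yB obase _ _ _ _ oW).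
    - by move=> u uU; rewrite /y /extend uU.
    - by lra.
    - by lra.
    - move=> u; rewrite opprK !inE negb_and => /andP[/orP[/negPf uV|]].
        by rewrite uV.
      by rewrite -ltNge thrE => lu uV; rewrite -lE // ltW.
  have WV := subset_trans oU UV.
  apply: (very_negative_forced taF yB WV oW' minX clX vV).
  apply: lt_le_trans yv _; rewrite thr_def -lVE opprB.
  have -> : 2 * d * lV - #|V|%:R * - (2 * lV * d)
      = (#|V|%:R + 1) * (2 * lV * d).
    by ring.
  by rewrite ler_nM2r //; lra.
have [snd2 [V2V arcs2] out2 cost2] :=
  contract_forcedM_val_cost EO_ge0 enumP snd' forced1.
set s2 := contract_forcedM _ _ _ _ in snd2 V2V arcs2 out2 cost2 *.
case=> <-; split.
  split; first exact: contract_scc_sound snd2.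
  exact: contract_scc_transitive snd2.
have card3 := contract_scc_card s2.1.
have nonarcs3 := contract_scc_nonarcs snd2.
set s3 := contract_scc s2.1 in card3 nonarcs3 *.
pose Z := [set z in V | arc_test V (evalf s) F y ts z].
have ZV : (#|Z| <= #|V|)%N.
  by apply/subset_leq_card/subsetP => z; rewrite inE => /andP[].
exists U, p, #|Z|; split=> //.
  (* If no node is removed, no coordinate is below thr, so all elements of the
     previous level pass the test. *)
  have [shrink|same] := boolP (nodes s2.1 \proper V).
    left; split; first exact: leq_ltn_trans card3 (proper_card shrink).
    apply: leq_trans nonarcs3 _; rewrite arcs2.
    exact: nonarcs_restrict.
  have V2E : nodes s2.1 = V.
    by apply/eqP; move: same; rewrite properEneq [_ \subset V]V2V andbT negbK.
  have yge : {in V, forall v, - - thr <= y v}.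
    move=> v vV; rewrite opprK leNgt; apply/negP => /(out2 v vV).
    by rewrite V2E vV.
  have levelZ : level V l.1 (2 * lV) Q p.+1 \subset Z.
    apply/subsetP => z; rewrite !inE thrE' => /andP[zV lz]; rewrite zV /=.
    apply/negPn/negP; rewrite -leNgt => small.
    have tau0 : 0 <= - thr.
      by rewrite thr_def oppr_ge0 nmulr_lle0 //; lra.
    have ts_gt0 : (0 < size ts)%N.
      by case: (ts) (decomposition_nonempty dec).
    have [|_ _ big] := @base_const_big (size ts) #|V| ts_gt0 _ Vgt0 Vn.
      by rewrite tsz.
    have := ell_ge_of_failed_test taF yB zV tau0 small yge.
    rewrite -lE // thr_def -mulNr opprK.
    move: lz big; rewrite -/Q; set C := 2 * (n * n) + 1.
    set X := (_ * #|V|%:R + 1 : R).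
    move=> lz big.
    have : Q * (2 * lV * d) < C * X * (2 * lV * d) by rewrite ltr_nM2r.
    have : C * (2 * lV * d) * X = C * X * (2 * lV * d) by ring.
    lra.
  right; split.
  - exact: leq_trans card3 (subset_leq_card V2V).
  - by apply: leq_trans half _; rewrite leq_mul2l subset_leq_card.
  - apply: leq_trans (leq_add nonarcs3 (leqnn _)) _; rewrite arcs2 V2E.
    apply: nonarcs_new_heads => // z; rewrite inE => /andP[zV /(newF' z zV)].
    case=> v; rewrite !inE => /andP[vz vV] vzF'; exists v; split=> //.
    by apply: contra vz; apply: connect1.
have := @overhead_bound #|V|%:R (EO + n) (size ts)%:R #|V :\: U|%:R #|Z|%:R n1.
rewrite VnR ler0n => /(_ isT (erefl _)).
have -> : (size ts)%:R <= ck%:R * n :> R.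
  by rewrite -natrM ler_nat tsz; apply: leq_trans kappa_le.
rewrite !ler0n !ler_nat subset_leq_card ?subsetDl // => /(_ isT isT isT).
move: addc; rewrite /test_cost /push_cost -/Z.
move: ec; rewrite (ordering_size ovs).
move: levc; rewrite -natr1.
move: cost2; rewrite /=.
rewrite -/d -/F.
lra.
Qed.

End Iteration.

(** * The run of the algorithm *)

Section Potentials.
Variable R : realType.

(** The factors of [q - q' = (sqrt q - sqrt q') (sqrt q + sqrt q')] are compared
    with [sqrt q + sqrt q' <= 2 m].  Dividing by [sqrt q] instead of [m] makes
    the sum over all iterations telescope although [m] decreases. *)
Lemma sqrt_drop (q q' u m : R) : 0 <= q' -> 0 <= u -> 0 < m ->
  q <= m ^+ 2 -> 2 * q' + u <= 2 * q ->
  u <= m * (4 * Num.sqrt q - 4 * Num.sqrt q').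
Proof.
move=> q'0 u0 m0 qm drop.
have q0 : 0 <= q by lra.
have a2 := sqr_sqrtr q0; have b2 := sqr_sqrtr q'0.
have a0 := sqrtr_ge0 q; have b0 := sqrtr_ge0 q'.
have am : Num.sqrt q <= m.
  by rewrite -[leRHS]gtr0_norm // -sqrtr_sqr ler_wsqrtr.
have ba : Num.sqrt q' <= Num.sqrt q by rewrite ler_wsqrtr //; lra.
move: a2 b2 a0 b0 am ba; set a := Num.sqrt q; set b := Num.sqrt q'.
move=> a2 b2 a0 b0 am ba.
have : u <= 2 * ((a + b) * (a - b)).
  have -> : (a + b) * (a - b) = a ^+ 2 - b ^+ 2 by ring.
  lra.
have : (a + b) * (a - b) <= 2 * m * (a - b) by apply: ler_wpM2r; lra.
lra.
Qed.

Lemma exists_max (A : Type) (g : A -> \bar R) (x : A) (s : seq A) :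
  exists2 y, y = x \/ List.In y s &
    forall z, z = x \/ List.In z s -> (g z <= g y)%E.
Proof.
elim: s => [|a s [y ys maxy]].
  by exists x => [|z [->|[]]]; first left.
case: (leP (g a) (g y)) => ay.
  exists y => [|z [->|[<- //|zs]]].
  - by case: ys => [|ys]; [left | right; right].
  - by apply: maxy; left.
  - by apply: maxy; right.
exists a => [|z [->|[<- //|zs]]]; first by right; left.
- by apply: le_trans (ltW ay); apply: maxy; left.
- by apply: le_trans (ltW ay); apply: maxy; right.
Qed.

End Potentials.

Section Run.
Variables (R : realType) (V0 : finType).
Local Notation N := {set V0}.
Variables (fO : {set V0} -> R) (EO : R) (kappa : nat) (O : sfm_oracle R N).
Variables (enumS : {set N} -> seq N) (ck : nat).
Hypothesis submodular_fO : submodular_on [set: V0] fO.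
Hypothesis fO_set0 : fO set0 = 0.
Hypothesis fO_setT : fO [set: V0] <= 0.
Hypothesis EO_ge0 : 0 <= EO.
Hypothesis kappa_le : (kappa <= ck * #|V0|)%N.
Hypothesis oracleP : approx_sfm #|V0| kappa O.
Hypothesis enumP : forall S, ordering S (enumS S).
Implicit Types (s t : state R V0) (X Y A U : {set N}) (d G : R).

Local Notation n := (#|V0|%:R : R).
Local Notation init := (init fO EO).
Local Notation loop_invariant := (loop_invariant fO EO).
Local Notation reached := (reached fO EO kappa O enumS).
Local Notation runs_from := (runs_from kappa O enumS).
Local Notation oracle_delta := (oracle_delta R V0 kappa).
Local Notation overhead := (overhead V0 EO ck).

Lemma cover_singletons X : X \subset nodes init ->
  cover X = [set v | [set v] \in X].
Proof.
move=> XV; apply/setP => v; rewrite inE; apply/bigcupP/idP => [[u uX vu]|vX].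
  have /imsetP[w _ uE] := subsetP XV u uX.
  by move: vu uX; rewrite uE inE => /eqP ->.
by exists [set v]; rewrite ?inE.
Qed.

Lemma init_invariant : loop_invariant init.
Proof.
have coverV : cover (nodes init) = [set: V0].
  by rewrite cover_singletons //; apply/setP => v; rewrite !inE imset_f.
have opt X : minimizer (nodes init) (fval init) X -> optimal fO X.
  move=> [XV minX] Y; have YV : [set [set v] | v in Y] \subset nodes init.
    by apply: imsetS; apply/subsetP.
  have := minX _ YV; rewrite /fval /= (cover_singletons YV).
  suff -> : [set v | [set v] \in [set [set v] | v in Y]] = Y by [].
  by apply/setP => v; rewrite inE mem_imset //; apply: set1_inj.
split; last by move=> a b c; rewrite /arc /= inE.
split => //=.
- apply/trivIsetP => _ _ /imsetP[u _ ->] /imsetP[v _ ->] uv.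
  by rewrite disjoints1 inE; apply: contra uv => /eqP ->.
- by apply/imsetP => -[v _ /setP/(_ v)]; rewrite !inE eqxx.
- exact: leq_imset_card.
- move=> X Y XV YV; rewrite /fval /=.
  have -> : cover (X :&: Y) = cover X :&: cover Y.
    rewrite !cover_singletons //; first by apply/setP => v; rewrite !inE.
    exact: subset_trans (subsetIl _ _) XV.
  by rewrite /cover bigcup_setU; apply: submodular_fO; apply: subsetT.
- by rewrite /fval /= /cover big_set0.
- by rewrite /fval /= -/(nodes init) coverV.
- exact: sub0set.
- by move=> u; rewrite /arc /= inE.
- by move=> X _ u v; rewrite inE.
- by move=> X /opt + _; rewrite setU0.
- by move=> /opt.
- by move=> X; rewrite lerDl subr_ge0 ler_nat; apply: leq_imset_card.
Qed.

Lemma reached_invariant s : reached s -> loop_invariant s.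
Proof.
elim=> [|t s' _ inv next]; first exact: init_invariant.
by have [] := iterationM_next EO_ge0 kappa_le oracleP enumP inv next.
Qed.

(** The weight [n] of a node makes its disappearance pay for the at most [n]
    pushes of that iteration. *)
Definition length_potential s := (nonarcs s + #|V0| * #|nodes s|)%N.

Definition level_potential s : R :=
  4 * Num.sqrt (nonarcs s)%:R + #|nodes s|%:R.

Lemma nonarcs_le s : (nonarcs s)%:R <= #|nodes s|%:R ^+ 2 :> R.
Proof.
rewrite -natrX ler_nat expnS expn1 -cardsX.
exact/subset_leq_card/subsetDl.
Qed.

Lemma level_potential_drop s s' U succ : U \subset nodes s -> U != set0 ->
  progress s s' U succ ->
  #|U|%:R <= #|nodes s|%:R * (level_potential s - level_potential s').
Proof.
move=> UV U0 prog.
have Um : #|U|%:R <= #|nodes s|%:R :> R by rewrite ler_nat subset_leq_card.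
have U1 : 1 <= #|U|%:R :> R by rewrite ler1n card_gt0.
case: prog => [[lt_m le_q]|[le_m le_U le_q]].
  have : #|nodes s'|%:R + 1 <= #|nodes s|%:R :> R by rewrite natr1 ler_nat.
  have : Num.sqrt (nonarcs s')%:R <= Num.sqrt (nonarcs s)%:R :> R.
    by rewrite ler_wsqrtr // ler_nat.
  rewrite /level_potential => ? ?; apply: le_trans Um _.
  by rewrite ler_peMr //; lra.
have m'm : #|nodes s'|%:R <= #|nodes s|%:R :> R by rewrite ler_nat.
apply: (@le_trans _ _ (#|nodes s|%:R *
    (4 * Num.sqrt (nonarcs s)%:R - 4 * Num.sqrt (nonarcs s')%:R))).
  apply: sqrt_drop; rewrite ?nonarcs_le //; first lra.
  rewrite -!natrM -natrD ler_nat mulnC -[X in (X + _)%N]mulnC.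
  by apply: leq_trans (leq_add (leqnn _) le_U) _; rewrite -mulnDr leq_mul2l.
by apply: ler_wpM2l => //; rewrite /level_potential; lra.
Qed.

Lemma length_potential_drop s s' U succ : loop_invariant s ->
  U \subset nodes s -> U != set0 -> (succ <= #|nodes s|)%N ->
  progress s s' U succ ->
  (1 + succ + 2 * length_potential s' <= 2 * length_potential s)%N /\
  (length_potential s' < length_potential s)%N.
Proof.
case=> snd _ UV U0 succ_le prog.
have mn := sound_card snd.
have Um : (#|U| <= #|nodes s|)%N by apply: subset_leq_card.
have U1 : (0 < #|U|)%N by rewrite card_gt0.
rewrite /length_potential.
case: prog => [[lt_m le_q]|[le_m le_U le_q]].
  have : (#|V0| * #|nodes s'| + #|V0| <= #|V0| * #|nodes s|)%N.
    by rewrite addnC -mulnS leq_mul2l lt_m orbT.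
  lia.
have : (#|V0| * #|nodes s'| <= #|V0| * #|nodes s|)%N.
  by rewrite leq_mul2l le_m orbT.
lia.
Qed.

(** The running time of the oracle is unrelated for different accuracies, so
    the run is only described relative to a common bound [G] for all accuracies
    in [ds]. *)
Definition oracle_calls_below (ds : seq R) G :=
  forall t U d, reached t -> U \subset nodes t -> U != set0 -> List.In d ds ->
    #|nodes t|%:R * orc_time O U (fdown (nodes t) (fval t) (arcs t)) d
      <= #|U|%:R * G.

Lemma overhead_ge0 : 0 <= overhead.
Proof.
by rewrite /overhead mulr_ge0 ?addr_ge0 ?mulr_ge0 ?exprn_ge0 ?ler0n.
Qed.

Lemma stop_cost_le s c : loop_invariant s -> (0 < #|V0|)%N ->
  c <= #|nodes s|%:R * (2 * (EO + n) + 3) + 1 -> c <= overhead.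
Proof.
move=> [snd _] n0 /le_trans; apply.
have n1 : 1 <= n by rewrite ler1n.
have mn : #|nodes s|%:R <= n :> R by rewrite ler_nat (sound_card snd).
have m0 : 0 <= #|nodes s|%:R :> R by rewrite ler0n.
have := @overhead_bound R V0 EO ck EO_ge0 #|nodes s|%:R (EO + n) 0 0 0 n1.
rewrite m0 mn !lexx mulr_ge0 ?ler0n // => /(_ isT erefl isT isT isT).
have : 0 <= #|nodes s|%:R * EO by rewrite mulr_ge0.
have : 0 <= #|nodes s|%:R * n by rewrite mulr_ge0 ?ler0n.
have : 0 <= #|nodes s|%:R * #|nodes s|%:R :> R by rewrite mulr_ge0.
have := EO_ge0.
lra.
Qed.

Lemma run_stop s : reached s -> (iterationM kappa O enumS s).1 = None ->
  exists S time ds,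
  [/\ runs_from s S time,
      forall Y : {set V0}, fO S <= fO Y,
      forall d, List.In d ds -> exists2 p, d = oracle_delta p &
        (2 ^ p <= #|V0|)%N &
      forall G, 0 <= G -> (0 < #|V0|)%N -> oracle_calls_below ds G ->
        time <= level_potential s * G
                + overhead * (1 + 2 * (length_potential s)%:R)].
Proof.
move=> /reached_invariant inv next.
have [opt cost] := iterationM_stop enumP inv next.
exists (cover (taken s)), (iterationM kappa O enumS s).2, [::].
split=> // [|G G0 n0 _].
  by apply: runs_stop; rewrite -next; apply: surjective_pairing.
have := stop_cost_le inv n0 cost.
have : 0 <= level_potential s * G.
  by rewrite mulr_ge0 // addr_ge0 ?mulr_ge0 ?sqrtr_ge0 ?ler0n.
have : 0 <= overhead * (length_potential s)%:R.
  by rewrite mulr_ge0 ?overhead_ge0 ?ler0n.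
lra.
Qed.

Lemma run_exists k s : reached s -> (length_potential s <= k)%N ->
  exists S time ds,
  [/\ runs_from s S time,
      forall Y : {set V0}, fO S <= fO Y,
      forall d, List.In d ds -> exists2 p, d = oracle_delta p &
        (2 ^ p <= #|V0|)%N &
      forall G, 0 <= G -> (0 < #|V0|)%N -> oracle_calls_below ds G ->
        time <= level_potential s * G
                + overhead * (1 + 2 * (length_potential s)%:R)].
Proof.
elim: k s => [|k IH] s reach_s pot_le; have inv := reached_invariant reach_s;
  have [snd _] := inv; case next: (iterationM kappa O enumS s).1 => [s'|];
  try exact: run_stop.
- have [_ [U [p [succ [[UV U0 _] succ_le prog _]]]]] :=
    iterationM_next EO_ge0 kappa_le oracleP enumP inv next.
  have [_] := length_potential_drop inv UV U0 succ_le prog.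
  by rewrite ltnNge (leq_trans pot_le).
- have [_ [U [p [succ [[UV U0 pV] succ_le prog cost]]]]] :=
    iterationM_next EO_ge0 kappa_le oracleP enumP inv next.
  have [drop lt_pot] := length_potential_drop inv UV U0 succ_le prog.
  have level_drop := level_potential_drop UV U0 prog.
  have [S [time [ds [run opt dsP timeP]]]] :=
    IH s' (reached_next reach_s next) (leq_trans lt_pot pot_le).
  exists S, ((iterationM kappa O enumS s).2 + time), (oracle_delta p :: ds).
  split=> //.
  + apply: runs_next run; rewrite -next; exact: surjective_pairing.
  + move=> d [<-|/dsP //]; exists p => //.
    exact: leq_trans pV (sound_card snd).
  + move=> G G0 n0 below.
    have below' : oracle_calls_below ds G.
      by move=> t U' d rt U'V U'0 dd; apply: below => //; right.
    have := timeP G G0 n0 below'.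
    have := below s U (oracle_delta p) reach_s UV U0 (or_introl erefl).
    set tau := orc_time _ _ _ _ in cost *.
    move=> tau_le time_le.
    have m0 : 0 < #|nodes s|%:R :> R.
      rewrite ltr0n; apply: leq_trans (subset_leq_card UV); by rewrite card_gt0.
    have tauG : tau <= (level_potential s - level_potential s') * G.
      rewrite -(ler_pM2l m0) mulrA; apply: le_trans tau_le _.
      exact: ler_wpM2r.
    have dropR : 1 + succ%:R + 2 * (length_potential s')%:R
        <= 2 * (length_potential s)%:R :> R.
      by move: drop; rewrite -(ler_nat R) !natrD !natrM; lra.
    have := ler_wpM2l overhead_ge0 dropR.
    lra.
Qed.

Lemma init_potentials :
  level_potential init <= 5 * n /\ (length_potential init)%:R <= 2 * n ^+ 2.
Proof.
have m_le : (#|nodes init| <= #|V0|)%N by apply: leq_imset_card.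
have m_leR : #|nodes init|%:R <= n by rewrite ler_nat.
have m2 : #|nodes init|%:R ^+ 2 <= n ^+ 2 :> R by rewrite lerXn2r ?nnegrE.
have q_le := le_trans (nonarcs_le init) m2.
split.
  have : Num.sqrt (nonarcs init)%:R <= n.
    by rewrite -[leRHS]ger0_norm // -sqrtr_sqr ler_wsqrtr.
  rewrite /level_potential; lra.
have : n * #|nodes init|%:R <= n ^+ 2 by rewrite expr2 ler_wpM2l.
rewrite /length_potential natrD natrM; lra.
Qed.

Definition ratio_const : R := 40 * ck%:R + 650.

Lemma run_from_init : exists S time ds,
  [/\ enhanced_sfm fO EO kappa O enumS S time,
      forall Y : {set V0}, fO S <= fO Y,
      forall d, List.In d ds -> exists2 p, d = oracle_delta p &
        (2 ^ p <= #|V0|)%N &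
      forall G, 0 <= G -> (0 < #|V0|)%N -> oracle_calls_below ds G ->
        time <= 5 * n * G + ratio_const * (n ^+ 3 * EO + n ^+ 4)].
Proof.
have [S [time [ds [run opt dsP timeP]]]] :=
  run_exists (reached_init _ _ _ _ _) (leqnn (length_potential init)).
exists S, time, ds; split=> // G G0 n0 /(timeP G G0 n0)/le_trans; apply.
have [lev len] := init_potentials.
have n1 : 1 <= n by rewrite ler1n.
have n2 : 1 <= n ^+ 2 by rewrite exprn_ege1.
have := ler_wpM2r G0 lev.
have : overhead * (1 + 2 * (length_potential init)%:R)
    <= overhead * (5 * n ^+ 2).
  by apply: ler_wpM2l; [exact: overhead_ge0 | lra].
have -> : overhead * (5 * n ^+ 2) = ratio_const * (n ^+ 3 * EO + n ^+ 4).
  by rewrite /overhead /ratio_const; ring.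
lra.
Qed.

(** * Size of the accuracies *)

Definition exponent : R := 12 * (4 * ck + 2)%:R / ln 2.

Lemma ln2_gt0 : 0 < ln 2 :> R.
Proof. by rewrite ln_gt0 // ltr1n. Qed.

(** Both [4 kappa n <= 4 ck n ^ 2] and the level index are estimated for
    [n >= 2] by [4 ck <= n ^ (4 ck)] and [p + 2 <= 3 ln n / ln 2]. *)
Lemma oracle_delta_bounds p : (2 <= #|V0|)%N -> (2 ^ p <= #|V0|)%N ->
  [/\ 0 < oracle_delta p, oracle_delta p <= 2^-1 &
      - ln (oracle_delta p) <= exponent * ln n ^+ 2].
Proof.
move=> n2 pn; have n0 : (0 < #|V0|)%N by apply: leq_trans n2.
have kappa0 := kappa_gt0 oracleP n0.
have n0R : 0 < n by rewrite ltr0n.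
have ln2 := ln2_gt0.
have lnn : ln 2 <= ln n by rewrite ler_ln ?posrE ?ltr0n // ler_nat.
pose e := ((p.+2) * 4)%N.
have deltaE : oracle_delta p = ((4 * kappa * #|V0|)%N ^ e)%:R^-1.
  rewrite /oracle_delta /base_const div1r -exprM mulnC -/e natrX.
  by rewrite !natrM.
have base4 : (4 <= 4 * kappa * #|V0|)%N.
  by rewrite -mulnA leq_pmulr // muln_gt0 kappa0.
have big0 : (0 < (4 * kappa * #|V0|) ^ e)%N.
  by rewrite expn_gt0 (leq_trans _ base4).
split; rewrite deltaE.
- by rewrite invr_gt0 ltr0n.
- rewrite lef_pV2 ?posrE ?ltr0n // ler_nat.
  apply: leq_trans (leq_trans _ base4) _ => //.
  by rewrite -{1}[(4 * kappa * _)%N]expn1 leq_exp2l // (leq_trans _ base4).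
rewrite lnV ?posrE ?ltr0n // opprK.
have base_le : (4 * kappa * #|V0| <= #|V0| ^ (4 * ck + 2))%N.
  rewrite expnD -mulnA; apply: leq_trans (_ : 4 * ck * (#|V0| * #|V0|) <= _)%N.
    by rewrite -[X in (_ <= X)%N]mulnA leq_mul2l mulnA leq_mul2r kappa_le orbT.
  rewrite -[(#|V0| ^ 2)%N]/(#|V0| * #|V0|)%N leq_mul2r.
  apply/orP; right; apply: leq_trans (ltnW (ltn_expl (4 * ck) n2)) _.
  by [].
have big_le : (((4 * kappa * #|V0|) ^ e)%:R : R) <= n ^+ ((4 * ck + 2) * e).
  by rewrite -natrX ler_nat expnM leq_exp2r.
have e_le : e%:R * ln 2 <= 12 * ln n :> R.
  have : p%:R * ln 2 <= ln n :> R.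
    rewrite mulr_natl -lnXn // ler_ln ?posrE ?exprn_gt0 //.
    by rewrite -natrX ler_nat.
  by rewrite /e natrM -[p.+2]addn2 natrD; lra.
apply: (@le_trans _ _ (((4 * ck + 2) * e)%:R * ln n)).
  rewrite mulr_natl -lnXn // ler_ln ?posrE ?ltr0n // exprn_gt0 //.
rewrite natrM /exponent.
have -> : 12 * (4 * ck + 2)%:R / ln 2 * ln n ^+ 2
        = (4 * ck + 2)%:R * ln n * (12 * ln n / ln 2) :> R by ring.
rewrite mulrAC; apply: ler_wpM2l; first by rewrite mulr_ge0 ?ler0n //; lra.
by rewrite ler_pdivlMr.
Qed.

End Run.

(** * Running times *)

Section RunningTimes.
Variables (R : realType) (V0 : finType).
Local Notation N := {set V0}.
Variables (fO : {set V0} -> R) (EO : R) (kappa : nat) (O : sfm_oracle R N).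
Variables (enumS : {set N} -> seq N) (ck : nat).
Hypothesis submodular_fO : submodular_on [set: V0] fO.
Hypothesis fO_set0 : fO set0 = 0.
Hypothesis fO_setT : fO [set: V0] <= 0.
Hypothesis EO_ge0 : 0 <= EO.
Hypothesis kappa_le : (kappa <= ck * #|V0|)%N.
Hypothesis oracleP : approx_sfm #|V0| kappa O.
Hypothesis enumP : forall S, ordering S (enumS S).
Hypothesis orc_time_ge0 : forall U h delta, 0 <= orc_time O U h delta.
Hypothesis n_ge2 : (2 <= #|V0|)%N.
Variables (time : R) (ds : seq R).
Hypothesis dsP : forall d, List.In d ds ->
  exists2 p, d = oracle_delta R V0 kappa p & (2 ^ p <= #|V0|)%N.

Local Notation n := (#|V0|%:R : R).
Local Notation below := (oracle_calls_below fO EO kappa O enumS ds).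

Hypothesis timeP : forall G : R, 0 <= G -> (0 < #|V0|)%N -> below G ->
  time <= 5 * n * G + ratio_const R ck * (n ^+ 3 * EO + n ^+ 4).

Let n_gt0 : (0 < #|V0|)%N. Proof. exact: leq_trans n_ge2. Qed.
Let n_gt0R : 0 < n. Proof. by rewrite ltr0n. Qed.

Let reached_inv t : reached fO EO kappa O enumS t -> loop_invariant fO EO t.
Proof.
exact: reached_invariant submodular_fO fO_set0 fO_setT EO_ge0 kappa_le oracleP
  enumP t.
Qed.

Lemma deltas_pos d : List.In d ds -> 0 < d.
Proof.
move=> /dsP[p -> pn].
by have [] := oracle_delta_bounds kappa_le oracleP n_ge2 pn.
Qed.

Lemma deltas_range d : d = 1 \/ List.In d ds ->
  n `^ (- (exponent R ck * ln n)) <= d <= 1.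
Proof.
have lnn : 0 <= ln n by rewrite ln_ge0 // ler1n.
have e0 : 0 <= exponent R ck.
  by rewrite !mulr_ge0 ?ler0n ?invr_ge0 ?ltW ?ln2_gt0.
have en : 0 <= exponent R ck * ln n ^+ 2 by rewrite mulr_ge0 ?sqr_ge0.
suff main d' : 0 < d' -> d' <= 1 -> - ln d' <= exponent R ck * ln n ^+ 2 ->
    n `^ (- (exponent R ck * ln n)) <= d' <= 1.
  case=> [->|/dsP[p -> pn]]; first by apply: main; rewrite ?ln1 ?oppr0.
  have [d0 d1 dl] := oracle_delta_bounds kappa_le oracleP n_ge2 pn.
  by apply: main => //; lra.
move=> d0 d1 dl; rewrite d1 andbT -ler_ln ?posrE ?powR_gt0 // ln_powR.
by rewrite mulNr -mulrA -expr2 lerNl.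
Qed.

(** Restricting the ground set scales the oracle time at least linearly, so
    every call is charged to a call on the whole current ground set; the
    accuracy with the largest bound serves for all of them.  The additional
    accuracy 1 covers a run without oracle calls. *)
Lemma linear_time : at_least_linear O -> exists2 delta : R,
  n `^ (- (exponent R ck * ln n)) <= delta <= 1 &
  (time%:E <= (ratio_const R ck)%:E *
     (n%:E * AO_down fO EO kappa O enumS delta
      + (n ^+ 3 * EO + n ^+ 4)%:E))%E.
Proof.
move=> linO.
have C5 : 5 <= ratio_const R ck.
  by rewrite /ratio_const; have : 0 <= ck%:R :> R by []; lra.
have [delta deltaP maxd] := exists_max (AO_down fO EO kappa O enumS) 1 ds.
exists delta; first exact: deltas_range.
have AO_ge t d : reached fO EO kappa O enumS t ->
    ((orc_time O (nodes t) (fdown (nodes t) (fval t) (arcs t)) d)%:E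
       <= AO_down fO EO kappa O enumS d)%E.
  move=> rt; apply: ereal_sup_ubound; exists t, (arcs t) => //; split=> //.
  exact: invariant_acyclic (reached_inv rt).
have AO0 : (0 <= AO_down fO EO kappa O enumS delta)%E.
  apply: le_trans (AO_ge _ _ (reached_init _ _ _ _ _)).
  by rewrite lee_fin.
case AOE : (AO_down fO EO kappa O enumS delta) AO0 => [G||] // G0.
- rewrite lee_fin in G0.
  have -> : ((ratio_const R ck)%:E *
      (n%:E * G%:E + (n ^+ 3 * EO + n ^+ 4)%:E))%E
    = (ratio_const R ck * (n * G + (n ^+ 3 * EO + n ^+ 4)))%:E by [].
  rewrite lee_fin.
  have belowG : below G.
    move=> t U d rt UV U0 dd; have inv := reached_inv rt.
    have taF := invariant_acyclic inv; have [snd _] := inv.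
    have subf := sound_submodular snd.
    apply: le_trans (linO _ _ _ _ U0 UV _ _ (deltas_pos dd)) _.
    + exact: fdown_submodular.
    + by rewrite fdown0 (sound_fval0 snd).
    apply: ler_wpM2l => //; rewrite -lee_fin -AOE.
    by apply: le_trans (AO_ge t d rt) _; apply: maxd; right.
  have := timeP G0 n_gt0 belowG.
  have : 5 * (n * G) <= ratio_const R ck * (n * G).
    by apply: ler_wpM2r => //; rewrite mulr_ge0 ?ler0n.
  lra.
- by rewrite gt0_muley ?lte_fin // addye // gt0_muley ?leey // lte_fin; lra.
Qed.

(** Here [#|nodes t| * #|U| ^ 4 <= #|U| * n ^ 4] replaces the linearity of the
    oracle time. *)
Lemma rescaling_time_bound C0 : rescaling_time fO EO kappa O enumS C0 ->
  time <= (5 * `|C0| * (1 / ln 2 + exponent R ck)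
           + ratio_const R ck / ln 2 ^+ 2)
          * ((n ^+ 5 * EO + n ^+ 6) * ln n ^+ 2).
Proof.
move=> resc; have ln2_pos := ln2_gt0 R; have n_pos := n_gt0R.
have n1 : 1 <= n by rewrite ler1n.
have lnn : ln 2 <= ln n by rewrite ler_ln ?posrE ?ltr0n // ler_nat.
have e0 : 0 <= exponent R ck by rewrite !mulr_ge0 ?ler0n ?invr_ge0 ?ltW.
set D := (1 / ln 2 + exponent R ck) * ln n ^+ 2.
have ln_le : ln n <= 1 / ln 2 * ln n ^+ 2.
  rewrite mulrC mulrA mulr1 ler_pdivlMr // expr2 ler_wpM2l //; lra.
have D0 : 0 <= D.
  by rewrite /D mulr_ge0 ?sqr_ge0 // addr_ge0 // divr_ge0 // ltW.
pose G := `|C0| * (n ^+ 4 * EO + n ^+ 5) * D.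
have G0 : 0 <= G.
  rewrite /G mulr_ge0 // mulr_ge0 // addr_ge0 ?exprn_ge0 //.
  by rewrite mulr_ge0 ?exprn_ge0.
have belowG : below G.
  move=> t U d rt UV U0 dd; have inv := reached_inv rt; have [snd _] := inv.
  have [p dE pn] := dsP dd.
  have [d0 d1 dl] := oracle_delta_bounds kappa_le oracleP n_ge2 pn.
  have := resc t (arcs t) U d rt (invariant_acyclic inv) U0 UV.
  rewrite dE d0 d1 => /(_ isT) /=; rewrite -dE.
  set tau := orc_time _ _ _ _; set u := #|U|%:R; set m := #|nodes t|%:R.
  have u1 : 1 <= u by rewrite ler1n card_gt0.
  have um : u <= m by rewrite ler_nat subset_leq_card.
  have mn : m <= n by rewrite ler_nat (sound_card snd).
  have lnu : ln (u / d) <= D.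
    rewrite ln_div ?posrE //; [|lra|by rewrite dE].
    have : ln u <= ln n by rewrite ler_ln ?posrE; lra.
    rewrite /D mulrDl dE; lra.
  have lnu0 : 0 <= ln (u / d).
    rewrite ln_ge0 // ler_pdivlMr ?dE // mul1r; lra.
  move=> tau_le.
  have X0 : 0 <= u ^+ 4 * EO + u ^+ 5.
    by rewrite addr_ge0 ?mulr_ge0 ?exprn_ge0 //; lra.
  have tau_le' : tau <= `|C0| * (u ^+ 4 * EO + u ^+ 5) * D.
    apply: le_trans tau_le _; apply: (@le_trans _ _
      (`|C0| * (u ^+ 4 * EO + u ^+ 5) * ln (u / d))).
      by rewrite !ler_wpM2r // ler_norm.
    by rewrite ler_wpM2l // mulr_ge0.
  have m0 : 0 <= m by lra.
  apply: le_trans (ler_wpM2l m0 tau_le') _.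
  have -> : m * (`|C0| * (u ^+ 4 * EO + u ^+ 5) * D)
      = (m * (u ^+ 4 * EO + u ^+ 5)) * (`|C0| * D) by ring.
  have -> : u * G = (u * (n ^+ 4 * EO + n ^+ 5)) * (`|C0| * D).
    by rewrite /G; ring.
  apply: ler_wpM2r; first by rewrite mulr_ge0.
  have -> : m * (u ^+ 4 * EO + u ^+ 5) = u * (m * (u ^+ 3 * EO + u ^+ 4)).
    by ring.
  have -> : n ^+ 4 * EO + n ^+ 5 = n * (n ^+ 3 * EO + n ^+ 4) by ring.
  have un : u <= n by lra.
  apply: ler_wpM2l; first by lra.
  apply: ler_pM => //.
    by rewrite addr_ge0 ?mulr_ge0 ?exprn_ge0 //; lra.
  by apply: lerD; rewrite ?ler_wpM2r // lerXn2r ?nnegrE //; lra.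
have := timeP G0 n_gt0 belowG.
have -> : 5 * n * G = 5 * `|C0| * (1 / ln 2 + exponent R ck)
    * ((n ^+ 5 * EO + n ^+ 6) * ln n ^+ 2) by rewrite /G /D; ring.
have Y0 : 0 <= n ^+ 3 * EO + n ^+ 4 by rewrite addr_ge0 ?mulr_ge0 ?exprn_ge0.
have C5 : 0 <= ratio_const R ck.
  by rewrite /ratio_const; have : 0 <= ck%:R :> R by []; lra.
have Y_le : n ^+ 3 * EO + n ^+ 4
    <= (n ^+ 5 * EO + n ^+ 6) * (ln n ^+ 2 / ln 2 ^+ 2).
  rewrite -[leLHS]mulr1; apply: ler_pM => //.
    have -> : n ^+ 5 * EO + n ^+ 6 = (n ^+ 3 * EO + n ^+ 4) * n ^+ 2 by ring.
    by rewrite ler_peMr // exprn_ege1.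
  by rewrite ler_pdivlMr ?exprn_gt0 // mul1r lerXn2r ?nnegrE //; lra.
have := ler_wpM2l C5 Y_le.
set A := 5 * `|C0| * _; set B := n ^+ 5 * EO + n ^+ 6.
have -> : (A + ratio_const R ck / ln 2 ^+ 2) * (B * ln n ^+ 2)
  = A * (B * ln n ^+ 2) + ratio_const R ck * (B * (ln n ^+ 2 / ln 2 ^+ 2)).
  by ring.
lra.
Qed.

End RunningTimes.

Theorem theorem4p12 (R : realType) (ck : nat) :
  exists C1 c : R, forall C0 : R, exists C2 : R,
  forall (V : finType) (f : {set V} -> R) (EO : R) (kappa : nat)
         (O : sfm_oracle R {set V}) (enumS : {set {set V}} -> seq {set V}),
    submodular_on [set: V] f -> f set0 = 0 -> f [set: V] <= 0 ->
    0 <= EO ->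
    (kappa <= ck * #|V|)%N -> approx_sfm #|V| kappa O ->
    (forall U h delta, 0 <= orc_time O U h delta) ->
    (forall S, ordering S (enumS S)) ->
    exists (S : {set V}) (time : R),
      [/\ enhanced_sfm f EO kappa O enumS S time,
          forall X : {set V}, f S <= f X,
          at_least_linear O -> (2 <= #|V|)%N ->
            exists2 delta : R,
              #|V|%:R `^ (- (c * ln #|V|%:R)) <= delta <= 1 &
              (time%:E <= C1%:E *
                 (#|V|%:R%:E * AO_down f EO kappa O enumS delta
                  + (#|V|%:R ^+ 3 * EO + #|V|%:R ^+ 4)%:E))%E &
          rescaling_time f EO kappa O enumS C0 -> (2 <= #|V|)%N ->
            time <= C2 * ((#|V|%:R ^+ 5 * EO + #|V|%:R ^+ 6)
                          * ln #|V|%:R ^+ 2)].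
Proof.
exists (ratio_const R ck), (exponent R ck) => C0.
exists (5 * `|C0| * (1 / ln 2 + exponent R ck) + ratio_const R ck / ln 2 ^+ 2).
move=> V f EO kappa O enumS subf f0 fV EO0 kappa_le oracleP orc_ge0 enumP.
have [S [time [ds [run opt dsP timeP]]]] :=
  run_from_init subf f0 fV EO0 kappa_le oracleP enumP.
exists S, time; split=> // [linO n2|resc n2].
  exact: linear_time dsP timeP linO.
exact: rescaling_time_bound dsP timeP _ resc.
Qed.
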